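(* Let $P$ be a tree poset of height $k$, and let $p=p(n)$ satisfy $pn\to\infty$. Let $\mathcal{P}(n,p)$ be the random subfamily of $\mathcal{B}_n$ in which each set of $\mathcal{B}_n$ is included independently with probability $p$. Then with probability tending to $1$ as $n\to\infty$, the largest subfamily of $\mathcal{P}(n,p)$ containing no induced copy of $P$ has size $(k-1+o(1))\,p\binom{n}{\lfloor n/2\rfloor}$.
   Context: $\mathcal{B}_n$ is the family of all subsets of $[n]$ ordered by inclusion. A tree poset is a finite poset whose Hasse diagram (as an undirected graph) is a tree; its height is the largest number of elements in a chain. An induced copy of $P$ in a family $\mathcal{F}$ is the image of an injective map $f:P\to\mathcal{F}$ with $f(x)\subsetneq f(y)$ if and only if $x<_P y$. *)

(* Defs.v *)
From HB Require Import structures.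
From mathcomp Require Import all_boot all_order all_algebra.
From mathcomp Require Import reals.
Set Implicit Arguments. Unset Strict Implicit. Unset Printing Implicit Defensive.
Import Order.TTheory GRing.Theory Num.Theory.
Local Open Scope order_scope.

Section PosetDefs.
Context {d : Order.disp_t} {T : finPOrderType d}.

Definition covers (x y : T) : bool :=
  (x < y) && [forall z : T, ~~ ((x < z) && (z < y))].

Definition hasse_adj (x y : T) : bool := covers x y || covers y x.

(* the Hasse diagram (undirected) is a tree: nonempty, connected,
   and has exactly #|T| - 1 edges (each undirected edge {x,y} with x below y
   is counted once as the ordered pair (x, y) with covers x y) *)
Definition tree_poset : Prop :=
  [/\ 0 < #|T|,
      (forall x y : T, connect hasse_adj x y) &
      #|[set e : T * T | covers e.1 e.2]| = (#|T| - 1)%N]%N.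

Definition is_chain (C : {set T}) : bool :=
  [forall x in C, forall y in C, (x <= y) || (y <= x)].

Definition height : nat := \max_(C : {set T} | is_chain C) #|C|.

Definition induced_copy (n : nat) (F : {set {set 'I_n}})
    (f : {ffun T -> {set 'I_n}}) : bool :=
  [&& injectiveb f,
      [forall x, f x \in F] &
      [forall x, forall y, (f x \proper f y) == (x < y)]].

Definition Pfree (n : nat) (F : {set {set 'I_n}}) : bool :=
  ~~ [exists f : {ffun T -> {set 'I_n}}, induced_copy F f].

Definition max_free (n : nat) (F : {set {set 'I_n}}) : nat :=
  \max_(G : {set {set 'I_n}} | (G \subset F) && Pfree G) #|G|.

End PosetDefs.

Arguments height {d} T.
Arguments max_free {d} T {n} F.

Local Open Scope ring_scope.

Definition prob_Pnq {R : realType} (n : nat) (q : R)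
    (E : pred {set {set 'I_n}}) : R :=
  \sum_(F : {set {set 'I_n}} | E F)
     q ^+ #|F| * (1 - q) ^+ (#|{: {set 'I_n}}| - #|F|)%N.
Arguments prob_Pnq {R} n q E.

(* Main.v *)
(* The lower bound comes from the height - 1 middle layers, which contain no chain with [height]
   elements, and a Chernoff bound.

   For the upper bound, let G be a family without an induced copy of the tree T, rooted somewhere.
   Going from the leaves to the root, one asks for each vertex w with parent v which sets z, used in
   the role of v, have many options for w in G.  A greedily chosen small fingerprint S of G provides
   t options to all z outside a set U, and no member of G that can play w has more than a few
   neighbours in U.  If some z in G had options everywhere, a random choice of the options would give
   an induced copy of T with root z.  Hence G is contained in the container of all x that are
   uncovered for the root and have few uncovered neighbours, which depends on the fingerprints only.

   A random full chain meets a container in fewer than height T points on average, up to o(1):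
   otherwise place vertices of T at points of the chain according to their level; a vertex
   whose point is uncovered has a child with the same property (few uncovered neighbours means
   that a random chain misses them), which is absurd at a leaf.

   A first round uses only pairs of sets at distance at least 3; its fingerprints have size
   O(M / n^2), where M is the size of the middle layer, and are so few that the union bound is free.
   It leaves containers of size O(M), in which a second round has fingerprints of size O(M / n), and
   the factor p^|S| for the fingerprint being present beats their number as p n tends to infinity. *)

Require Import Defs.
From HB Require Import structures.
From mathcomp Require Import all_boot all_order all_algebra all_fingroup.
From mathcomp Require Import reals sequences exp.
From mathcomp Require Import zify ring lra.
Set Implicit Arguments. Unset Strict Implicit. Unset Printing Implicit Defensive.
Import Order.TTheory GRing.Theory Num.Theory.

(** * Rooted trees and levels *)

Section RootedTree.
Local Open Scope order_scope.
Context {d : Order.disp_t} {T : finPOrderType d}.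

(** A set of the band at distance q from x lies on a random full chain through x with probability
    O(n^-q). So each member of a container may be allowed a small multiple of n^q uncovered
    neighbours, and a fingerprint then has O(|F| / n^q) members. The price is that sets closer than
    q are never linked, so a chain may meet the container in q (k - 1) points. Only q = 1 gives the
    sharp constant, but its fingerprints have size of order 2^n / n when it starts from all sets,
    and an arbitrary choice of that many sets has far too many outcomes. With q = 3 the crude bound
    2^n <= (n + 1) M leaves only exp(O(M / n)) tuples, which is negligible against exp(-c p M).

    The copy must be induced although options in different branches are chosen independently.
    Comparisons along a branch are enforced when an option is created. Across branches, an
    accidental inclusion forces some option to move a ground element that was fixed without looking
    at that option; since an element is moved by at most two options of a vertex, a constant number
    of options beats the union bound over these accidents. *)

Definition rooted_tree (root : T) (par : T -> T) (dist : T -> nat) : Prop :=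
  [/\ par root = root,
      forall w, w != root -> (dist (par w) < dist w)%N,
      forall w, w != root -> covers w (par w) || covers (par w) w &
      forall x y, covers x y ->
        ((y == par x) && (x != root)) || ((x == par y) && (y != root))].

Lemma covers_lt (x y : T) : covers x y -> x < y.
Proof. by case/andP. Qed.

(** Balls around any vertex define distances, and every other vertex takes a strictly closer
    neighbour as its parent. A vertex is determined by its parent edge because the parent is closer;
    as there are only [#|T| - 1] edges, counting shows that every cover is a parent edge. *)
Lemma tree_poset_rooted : tree_poset (T := T) ->
  exists root par dist, rooted_tree root par dist.
Proof.
case=> T0 conn cardE.
have [root _] : exists x : T, x \in T by apply/card_gt0P.
pose ball := fix ball m := if m is m'.+1 then
   ball m' :|: [set x | [exists y in ball m', hasse_adj y x]] else [set root].
have inball x : exists m, x \in ball m.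
  have /connectP[p] := conn root x.
  elim/last_ind: p x => [|p y IH] x; first by move=> _ ->; exists 0%N; rewrite /= inE.
  rewrite rcons_path last_rcons => /andP[pp adj] ->.
  have [m mP] := IH _ pp erefl.
  exists m.+1; rewrite /= !inE; apply/orP; right.
  by apply/existsP; exists (last root p); rewrite mP.
pose dist x := ex_minn (inball x).
have distP x : x \in ball (dist x) by rewrite /dist; case: ex_minnP.
have dist_min x m : x \in ball m -> (dist x <= m)%N.
  by rewrite /dist; case: ex_minnP => m' _; apply.
have ex_par x : x != root -> exists y, hasse_adj y x && (dist y < dist x)%N.
  move=> xr; move: (distP x) (@dist_min x).
  case: (dist x) => [|m]; first by rewrite /= inE (negbTE xr).
  rewrite /= !inE => /orP[xm /(_ _ xm)|]; first by rewrite ltnn.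
  case/existsP=> y /andP[ym adj] _; exists y.
  by rewrite adj ltnS dist_min.
pose par x := if pick (fun y => hasse_adj y x && (dist y < dist x)%N) is Some y
   then (if x == root then root else y) else root.
have parP x : x != root -> hasse_adj (par x) x && (dist (par x) < dist x)%N.
  move=> xr; rewrite /par; case: pickP => [y yP|]; first by rewrite (negbTE xr).
  by have [y yP] := ex_par x xr; move/(_ y); rewrite yP.
have parr : par root = root.
  by rewrite /par; case: pickP => // y _; rewrite eqxx.
pose phi w := if covers w (par w) then (w, par w) else (par w, w).
have phiE w : w != root -> phi w \in [set e : T * T | covers e.1 e.2].
  move=> wr; rewrite inE /phi; case: ifP => //= nc.
  by have /andP[] := parP w wr; rewrite /hasse_adj nc orbF.
have phi_inj : {in [set~ root] &, injective phi}.
  move=> x y; rewrite !inE => xr yr; rewrite /phi.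
  have /andP[_ dx] := parP x xr; have /andP[_ dy] := parP y yr.
  case: ifP => _; case: ifP => _ [] // e1 e2; exfalso.
  - by move: dx dy; rewrite -e1 e2; lia.
  - by move: dx dy; rewrite -e2 e1; lia.
have imE : phi @: [set~ root] = [set e : T * T | covers e.1 e.2].
  apply/eqP; rewrite eqEcard; apply/andP; split.
    by apply/subsetP=> e /imsetP[w]; rewrite !inE => wr ->; have := phiE w wr; rewrite inE.
  by rewrite card_in_imset // cardE cardsC1 subn1.
exists root, par, dist; split => // [w wr|w wr|x y cxy].
- by case/andP: (parP w wr).
- by case/andP: (parP w wr); rewrite /hasse_adj orbC.
- have : (x, y) \in phi @: [set~ root] by rewrite imE inE.
  case/imsetP=> w; rewrite !inE /phi => wr.
  by case: ifP => _ [-> ->]; rewrite eqxx wr ?orbT.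
Qed.

Section Branches.
Variables (root : T) (par : T -> T) (dist : T -> nat).
Hypothesis tree : rooted_tree root par dist.

(* Reflexive: a vertex is its own ancestor.  [root] is a fixed point of [par]. *)
Definition anc (w u : T) := fconnect par u w.

Lemma par_root : par root = root. Proof. by case: tree. Qed.
Lemma dist_par w : w != root -> (dist (par w) < dist w)%N. Proof. by case: tree => _ + _ _; apply. Qed.

Lemma anc_refl u : anc u u. Proof. exact: connect0. Qed.

Lemma anc_trans v w u : anc v w -> anc w u -> anc v u.
Proof. by rewrite /anc => vw wu; apply: connect_trans wu vw. Qed.

Lemma anc_par w : anc (par w) w. Proof. exact: fconnect1. Qed.

Lemma anc_iter w u : reflect (exists i, w = iter i par u) (anc w u).
Proof.
apply: (iffP idP) => [/iter_findex <-|[i ->]]; first by eexists.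
exact: fconnect_iter.
Qed.

Lemma anc_neq w u : anc w u -> w != u -> anc w (par u).
Proof.
case/anc_iter=> [[|i]] ->; first by rewrite eqxx.
by move=> _; apply/anc_iter; exists i; rewrite -iterSr.
Qed.

Lemma dist_par_le u : (dist (par u) <= dist u)%N.
Proof.
by have [->|/dist_par/ltnW//] := eqVneq u root; rewrite par_root.
Qed.

Lemma anc_dist w u : anc w u -> (dist w <= dist u)%N.
Proof.
case/anc_iter=> i ->; elim: i => //= i IH; exact: leq_trans (dist_par_le _) IH.
Qed.

Lemma anc_antisym w u : anc w u -> anc u w -> w = u.
Proof.
move=> wu uw; apply/eqP/negPn/negP=> neq.
have [ur|ur] := eqVneq u root.
  move/anc_iter: wu => [i ei]; case/eqP: neq; rewrite ei ur.
  by elim: i {ei} => //= i ->; exact: par_root.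
have := anc_dist (anc_neq wu neq); have := anc_dist uw; have := dist_par ur.
lia.
Qed.

Lemma anc_root u : anc root u.
Proof.
elim: {u}(dist u) {-2}u (leqnn (dist u)) => [|m IH] u du.
  by have [->|/dist_par] := eqVneq u root; [exact: anc_refl | lia].
have [->|ur] := eqVneq u root; first exact: anc_refl.
apply: anc_trans (anc_par u); apply: IH; have := dist_par ur; lia.
Qed.

Lemma anc_par_self w : anc w (par w) -> w = root.
Proof.
move=> a; apply/eqP/negPn/negP => wr.
by have := anc_dist a; have := dist_par wr; lia.
Qed.

(* A path of covers that leaves the branch of [w] uses the edge between [w] and its parent. *)
Lemma branch_lt w x y : anc w x -> ~~ anc w y ->
  (x < y -> [/\ w < par w, x <= w & par w <= y]) /\
  (y < x -> [/\ par w < w, w <= x & y <= par w]).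
Proof.
have [_ _ _ cov] := tree.
have covw u v : covers u v || covers v u -> anc w u -> ~~ anc w v -> u = w /\ v = par w.
  move=> cuv au av.
  have: ((v == par u) && (u != root)) || ((u == par v) && (v != root)).
    by case/orP: cuv => /cov // ; rewrite orbC.
  case/orP=> /andP[/eqP e nr].
    have [wu|neq] := eqVneq w u; first by rewrite e wu.
    by move: av; rewrite e anc_neq.
  by move: av; rewrite (anc_trans _ (anc_par v)) // -e.
(* An interval with nothing strictly inside is a cover, any other one splits at an inner point:
   induction on the number of inner points reduces a transitive property of [<] to covers. *)
have interval (u v : T) (Q : T -> T -> Prop) :
    (forall u v, covers u v -> Q u v) ->
    (forall u z v, u < z -> z < v -> Q u z -> Q z v -> Q u v) -> u < v -> Q u v.
  move=> Qc Qt; move: {2}#|_| (leqnn #|[set z | u < z < v]|) => m.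
  elim: m u v => [|m IH] u v card_m ltuv.
    apply: Qc; rewrite /covers ltuv; apply/forallP => z; apply/negP => zP.
    move: card_m; rewrite leqn0 cards_eq0 => /eqP/setP/(_ z).
    by rewrite !inE zP.
  have [z zP|nz] := pickP (fun z => u < z < v); last first.
    by apply: Qc; rewrite /covers ltuv; apply/forallP => z; rewrite nz.
  have /andP[uz zv] := zP.
  apply: (Qt u z v uz zv); apply: IH => //; rewrite -ltnS; apply: leq_trans card_m;
    apply: proper_card; apply/properP; split; try by exists z; rewrite !inE ?zP ?ltxx ?andbF.
  + by apply/subsetP=> x'; rewrite !inE => /andP[-> /lt_trans -> //].
  + by apply/subsetP=> x'; rewrite !inE => /andP[zx ->]; rewrite (lt_trans uz zx).
move=> ax ay; split.
- move=> ltxy; move: ax ay.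
  move: ltxy; apply: (interval _ _ (fun x y => anc w x -> ~~ anc w y -> [/\ w < par w, x <= w & par w <= y])).
    move=> u v cuv au av; have [e1 e2] : u = w /\ v = par w by apply: covw => //; rewrite cuv.
    by rewrite -e2 e1; split=> //; rewrite -e1 covers_lt.
  move=> u z v uz zv Q1 Q2 au av; have [az|az] := boolP (anc w z).
    by have [h1 h2 h3] := Q2 az av; split=> //; exact: le_trans (ltW uz) h2.
  by have [h1 h2 h3] := Q1 au az; split=> //; exact: le_trans h3 (ltW zv).
- move=> ltyx; move: ax ay.
  move: ltyx; apply: (interval _ _ (fun y x => anc w x -> ~~ anc w y -> [/\ par w < w, w <= x & y <= par w])).
    move=> u v cuv au av; have [e1 e2] : v = w /\ u = par w by apply: covw => //; rewrite cuv orbT.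
    by rewrite -e2 e1; split=> //; rewrite -e1 covers_lt.
  move=> u z v uz zv Q1 Q2 au av; have [az|az] := boolP (anc w z).
    by have [h1 h2 h3] := Q1 az av; split=> //; exact: le_trans h2 (ltW zv).
  by have [h1 h2 h3] := Q2 au az; split=> //; exact: le_trans (ltW uz) h3.
Qed.

End Branches.

Definition level (x : T) : nat :=
  \max_(C : {set T} | is_chain C && [forall y in C, y < x]) #|C|.

Lemma chain_setU1 (C : {set T}) x : is_chain C -> {in C, forall y, y < x} ->
  is_chain (x |: C) /\ #|x |: C| = #|C|.+1.
Proof.
move=> chC ltC; split; last first.
  by rewrite cardsU1; case: (boolP (x \in C)) => // /ltC; rewrite ltxx.
apply/forall_inP => y; rewrite !inE => /orP[/eqP->|yC]; apply/forall_inP => z; rewrite !inE.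
  by case/orP=> [/eqP->|/ltC/ltW ->]; rewrite ?lexx ?orbT.
case/orP=> [/eqP->|zC]; first by rewrite (ltW (ltC y yC)).
by move/forall_inP/(_ y yC)/forall_inP/(_ z zC): chC.
Qed.

Lemma level_witness x : exists C : {set T},
  [/\ is_chain C, {in C, forall y, y < x} & level x = #|C|].
Proof.
have P0 : is_chain (set0 : {set T}) && [forall y in (set0 : {set T}), y < x].
  by apply/andP; split; apply/forall_inP=> ?; rewrite inE.
rewrite /level (@bigop.bigmax_eq_arg _ set0 (fun C => is_chain C && [forall y in C, y < x]) _ P0).
by case: arg_maxnP => // C /andP[chC /forall_inP ltC] _; exists C.
Qed.

Lemma level_lt x y : x < y -> (level x < level y)%N.
Proof.
move=> xy; have [C [chC ltC ->]] := level_witness x.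
have [chU cU] := chain_setU1 chC ltC.
rewrite -cU; apply: (@leq_bigmax_cond _ _ (fun C : {set T} => #|C|)).
rewrite chU; apply/forall_inP => z; rewrite !inE => /orP[/eqP->//|/ltC /lt_trans]; exact.
Qed.

Lemma level_height x : (level x < height T)%N.
Proof.
have [C [chC ltC ->]] := level_witness x.
have [chU cU] := chain_setU1 chC ltC.
by rewrite -cU; apply: (@leq_bigmax_cond _ _ (fun C : {set T} => #|C|)).
Qed.

End RootedTree.

(** * Random full chains *)

Lemma sum_bool_card (I : finType) (P Q : pred I) :
  \sum_(i | P i) (Q i : nat) = #|[set i | P i && Q i]|.
Proof. by rewrite -sum1dep_card big_mkcondr; apply: eq_bigr => i _; case: (Q i). Qed.

Lemma leq_expl a b q : a <= b -> a ^ q <= b ^ q.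
Proof. by case: q => // q ab; rewrite leq_exp2r. Qed.

Lemma bin_half_max n i : 'C(n, i) <= 'C(n, n./2).
Proof.
have low j k : j + k <= n./2 -> 'C(n, j) <= 'C(n, j + k).
  elim: k => [|k IH] h; first by rewrite addn0.
  apply: leq_trans (IH _) _; first lia.
  rewrite addnS -(leq_pmul2l (ltn0Sn (j + k))) mul_bin_left leq_mul2r.
  by apply/orP; right; lia.
have [ni|iln] := ltnP n i; first by rewrite bin_small.
have [ih|hi] := leqP i n./2; first by have := low i (n./2 - i); rewrite subnKC //; apply.
rewrite -(bin_sub iln); have [nh|nh] := leqP (n - i) n./2; last by lia.
by have := low (n - i) (n./2 - (n - i)); rewrite subnKC //; apply.
Qed.

Section FullChains.
Variable n : nat.
Implicit Types (x y z : {set 'I_n}) (s : {perm 'I_n}).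

Definition symdiff x y : {set 'I_n} := [set a | (a \in x) != (a \in y)].

Definition prefix_set s (i : nat) : {set 'I_n} := [set s a | a in [set a : 'I_n | a < i]].

(* A full chain of the Boolean lattice is encoded by the permutation that lists its successive new elements. *)
Definition on_chain s x := prefix_set s #|x| == x.

Lemma symdiffC x y : symdiff x y = symdiff y x.
Proof. by apply/setP=> a; rewrite !inE eq_sym. Qed.

Lemma symdiff_sub x y : x \subset y -> symdiff x y = y :\: x.
Proof.
move/subsetP=> xy; apply/setP=> a; rewrite !inE.
by case ax: (a \in x); [rewrite xy | case: (a \in y)].
Qed.

Lemma card_symdiff_sub x y : x \subset y -> #|symdiff x y| = #|y| - #|x|.
Proof.
move=> xy; rewrite symdiff_sub // cardsD; congr (_ - _).
by move/setIidPr: xy => ->.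
Qed.

Lemma card_prefix s i : i <= n -> #|prefix_set s i| = i.
Proof.
move=> le_in; rewrite card_imset; last exact: perm_inj.
have -> : [set a : 'I_n | a < i] = [set widen_ord le_in b | b : 'I_i].
  apply/setP=> a; rewrite inE; apply/idP/imsetP => [ai|[b _ ->]]; last by rewrite /= ltn_ord.
  by exists (Ordinal ai) => //; apply: val_inj.
by rewrite card_imset ?card_ord // => b c /(congr1 val) /= /val_inj.
Qed.

Lemma prefix_sub s i j : i <= j -> prefix_set s i \subset prefix_set s j.
Proof.
move=> ij; apply: imsetS; apply/subsetP=> a; rewrite !inE => ai; exact: leq_trans ai ij.
Qed.

Lemma on_prefix s i : i <= n -> on_chain s (prefix_set s i).
Proof. by move=> le_in; rewrite /on_chain card_prefix. Qed.

Lemma on_chainP s x : on_chain s x -> x = prefix_set s #|x|.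
Proof. by move/eqP. Qed.

Lemma card_set_ord x : #|x| <= n.
Proof. by rewrite -[X in _ <= X](card_ord n) max_card. Qed.

Lemma on_chain_sub s x y : on_chain s x -> on_chain s y -> #|x| <= #|y| -> x \subset y.
Proof. by move=> /on_chainP-> /on_chainP->; rewrite !card_prefix ?card_set_ord //; exact: prefix_sub. Qed.

Lemma prefixM s t i : prefix_set (s * t)%g i = t @: prefix_set s i.
Proof.
by rewrite /prefix_set -imset_comp; apply: eq_imset => a; rewrite /= permM.
Qed.

Lemma on_chainM s t x : on_chain (s * t)%g (t @: x) = on_chain s x.
Proof.
rewrite /on_chain card_imset; last exact: perm_inj.
by rewrite prefixM (inj_eq (imset_inj (@perm_inj _ t))).
Qed.

Lemma card_permM (P : pred {perm 'I_n}) t : #|[set s | P (s * t)%g]| = #|[set s | P s]|.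
Proof.
rewrite -(card_imset _ (mulIg t)); apply: eq_card => s; rewrite !inE.
apply/imsetP/idP => [[s']|Ps]; first by rewrite inE => P' ->.
by exists (s * t^-1)%g; rewrite ?inE mulgKV.
Qed.

Definition passes x := #|[set s | on_chain s x]|.
Definition passes2 z x := #|[set s | on_chain s z && on_chain s x]|.

Lemma passes2C z x : passes2 z x = passes2 x z.
Proof. by rewrite /passes2; apply: eq_card => s; rewrite !inE andbC. Qed.

(** Label each ground element by its membership in the smaller and the larger set. Equal sizes give
    equal label counts, so some permutation carries one labelling to the other. *)
Lemma flag_perm z z' x : z \subset x -> z' \subset x -> #|z| = #|z'| ->
  exists t : {perm 'I_n}, t @: z = z' /\ t @: x = x.
Proof.
move=> zx zx' cz.
pose f (y : {set 'I_n}) a := (a \in y, a \in x).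
have : perm_eq [tuple f z a | a < n] [tuple f z' a | a < n].
  apply/allP => c _ /=; apply/eqP; rewrite /= !count_map.
  have cntE (P : pred 'I_n) : count P (enum 'I_n) = #|[set a | P a]|.
    by rewrite cardsE cardE enumT /enum_mem size_filter.
  rewrite -!enumT !cntE.
  have cE (y : {set 'I_n}) : y \subset x -> #|y| = #|z| ->
     #|[set a | preim (f y) (pred1 c) a]| =
     if c.1 then (if c.2 then #|z| else 0) else if c.2 then #|x| - #|z| else n - #|x|.
    move=> yx cy; case: c => [[] []] /=.
    - rewrite -cy; apply: eq_card => a; rewrite !inE /f xpair_eqE !eqb_id.
      by case ay: (a \in y) => //=; rewrite (subsetP yx).
    - apply/eqP; rewrite cards_eq0; apply/eqP/setP=> a; rewrite !inE /f xpair_eqE eqb_id.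
      by case ay: (a \in y) => //=; rewrite (subsetP yx).
    - have := cardsD x y; rewrite (setIidPr yx) cy => <-; apply: eq_card => a; rewrite !inE /f xpair_eqE eqb_id.
      by rewrite eqbF_neg.
    - have := cardsC x; rewrite [RHS]card_ord => /(canRL (addKn _)) <-; apply: eq_card => a.
      rewrite !inE /f xpair_eqE; case ax: (a \in x); rewrite ?andbF //=.
      by case ay: (a \in y) => //; rewrite (subsetP yx) in ax.
  by rewrite (cE z) // (cE z').
case/tuple_permP => t tP.
have ft a : f z a = f z' (t a).
  have : nth (f z a) [tuple f z a | a < n] a = f z a.
    by rewrite -(tnth_nth _ _ a) tnth_mktuple.
  by rewrite tP -(tnth_nth _ [tuple tnth _ _ | _ < n] a) !tnth_mktuple => <-.
exists t; split; apply/eqP; rewrite eqEcard card_imset ?cz ?leqnn ?andbT; try exact: perm_inj.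
- by apply/subsetP=> b /imsetP[a az ->]; case: (ft a) => <-.
- by apply/subsetP=> b /imsetP[a az ->]; case: (ft a) => _ <-.
Qed.

(** By [flag_perm] all subsets of [x] of size [#|z|] are met by equally many chains through [x], and
    each such chain meets exactly one of them. *)
Lemma passes2_bin z x : z \subset x -> passes2 z x * 'C(#|x|, #|z|) = passes x.
Proof.
move=> zx; pose D := [set A : {set 'I_n} | A \subset x & #|A| == #|z|].
have <- : #|D| = 'C(#|x|, #|z|).
  by rewrite -cards_draws; apply: eq_card => A; rewrite !inE.
have passE y : y \in D -> passes2 z x = \sum_(s | on_chain s x) on_chain s y.
  rewrite inE => /andP[yx /eqP cy].
  have [t [tz tx]] := flag_perm zx yx (esym cy).
  rewrite sum_bool_card.
  rewrite /passes2 -tz -{2}tx -(card_permM (fun s => on_chain s (t @: x) && on_chain s (t @: z)) t).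
  by apply: eq_card => s; rewrite !inE !on_chainM andbC.
rewrite mulnC -sum_nat_const (eq_bigr _ passE) exchange_big /= /passes.
rewrite -sum1dep_card; apply: eq_bigr => s sx.
have zn := card_set_ord z.
rewrite (bigD1 (prefix_set s #|z|)) /=; last first.
  rewrite inE card_prefix // eqxx andbT (on_chainP sx) prefix_sub //; exact: subset_leq_card.
rewrite on_prefix // big1 ?addn0 // => y; rewrite inE => /andP[/andP[_ /eqP cy] ny].
by apply/eqP; rewrite eqb0; apply: contra ny => /on_chainP ->; rewrite cy.
Qed.

Lemma passes_bin x : passes x * 'C(n, #|x|) = n`!.
Proof.
have -> : passes x = passes2 x setT.
  rewrite /passes /passes2; apply: eq_card => s; rewrite !inE.
  suff -> : on_chain s setT by rewrite andbT.
  by rewrite /on_chain eqEcard subsetT card_prefix ?card_set_ord ?leqnn.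
have := passes2_bin (subsetT x); rewrite cardsT card_ord => ->.
rewrite /passes -[n in n`!]card_ord -cardsT -card_perm; apply: eq_card => s.
rewrite inE /on_chain eqEcard subsetT card_prefix ?card_set_ord ?leqnn //=.
by apply/esym/subsetP=> a; rewrite inE.
Qed.

(** The downward count is turned into the upward one by counting nested pairs of the two sizes from
    either end, C(n,a) C(n-a,b-a) = C(n,b) C(b,a). *)
Lemma passes2_bin_up z x : z \subset x -> passes2 z x * 'C(n - #|z|, #|x| - #|z|) = passes z.
Proof.
move=> zx; have zn := card_set_ord z; have xn := card_set_ord x.
have czx := subset_leq_card zx.
apply/eqP; rewrite -(eqn_pmul2r (_ : 0 < 'C(n, #|z|))) ?bin_gt0 // passes_bin.
rewrite -(passes_bin x) -(passes2_bin zx) -!mulnA; apply/eqP; congr (_ * _).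
have := bin_fact zn; have := bin_fact xn; have := bin_fact czx.
have e : #|x| - #|z| <= n - #|z| by lia.
have := bin_fact e.
have -> : n - #|z| - (#|x| - #|z|) = n - #|x| by lia.
set A := 'C(_, _); set B := 'C(_, _); set C := 'C(_, _); set D := 'C(_, _).
have f1 := fact_gt0 #|z|; have f2 := fact_gt0 (#|x| - #|z|); have f3 := fact_gt0 (n - #|x|).
move=> h1 h2 h3 h4.
apply/eqP; rewrite -(eqn_pmul2r f1) -(eqn_pmul2r f2) -(eqn_pmul2r f3); apply/eqP.
transitivity (n`!).
  by rewrite -h4 -h1; nia.
by rewrite -h3 -h2; nia.
Qed.

Lemma bin_lower a g q : q <= g -> a.+1 ^ q <= q`! * 'C(a + g, a).
Proof.
move=> qg; apply: leq_trans (_ : q`! * 'C(a + q, a) <= _); last first.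
  by rewrite leq_mul2l leq_bin2l ?orbT // leq_add2l.
rewrite -[X in 'C(_, X)](addnK q a) bin_sub ?leq_addl // mulnC bin_ffact.
elim: q {qg} => // q IH; rewrite expnS addnS ffactnS /=.
by apply: leq_mul; rewrite ?ltnS ?leq_addr.
Qed.

(** Given [x], the chain is uniform on the sets of size [#|z|] comparable to [x], and [bin_lower]
    shows that there are at least m^q / q! of these. This estimate sets the tolerated number of
    uncovered neighbours. *)
Lemma passes2_le z x q m : z \subset x \/ x \subset z -> q <= #|symdiff z x| ->
  m <= #|z| -> m <= n - #|z| -> passes2 z x * m ^ q <= q`! * passes x.
Proof.
case=> [zx|xz] qg mz mnz.
  rewrite card_symdiff_sub // in qg; rewrite -(passes2_bin zx).
  rewrite mulnCA leq_mul2l; apply/orP; right.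
  rewrite -(subnKC (subset_leq_card zx)); apply: leq_trans (bin_lower _ qg).
  by apply: leq_expl; lia.
rewrite symdiffC card_symdiff_sub // in qg; rewrite passes2C -(passes2_bin_up xz).
rewrite mulnCA leq_mul2l; apply/orP; right.
have cz := card_set_ord z; have czx := subset_leq_card xz.
rewrite -bin_sub; last lia.
have -> : n - #|x| - (#|z| - #|x|) = n - #|z| by lia.
have -> : n - #|x| = n - #|z| + (#|z| - #|x|) by lia.
apply: leq_trans (bin_lower _ qg).
by apply: leq_expl; lia.
Qed.

(** Transpositions inside [x] fix [x], so all its elements are equally likely to be absent at level
    [j], and exactly [#|x| - j] of them are absent. *)
Lemma leave_below x a j : a \in x -> j <= #|x| ->
  #|[set s | on_chain s x && (a \notin prefix_set s j)]| * #|x| = (#|x| - j) * passes x.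
Proof.
move=> ax jx; rewrite mulnC -sum_nat_const.
have -> : \sum_(b in x) #|[set s | on_chain s x && (a \notin prefix_set s j)]| =
          \sum_(b in x) #|[set s | on_chain s x && (b \notin prefix_set s j)]|.
  apply: eq_bigr => b bx.
  have tx : tperm a b @: x = x.
    apply/eqP; rewrite eqEcard card_imset ?leqnn ?andbT; last exact: perm_inj.
    by apply/subsetP=> c /imsetP[c' cx ->]; case: tpermP => // ->.
  rewrite -(card_permM _ (tperm a b)); apply: eq_card => s; rewrite !inE.
  rewrite -{1}tx on_chainM; congr (_ && _).
  by rewrite -{1}(tpermR a b) prefixM mem_imset ?(inj_eq perm_inj) //; exact: perm_inj.
transitivity (\sum_(s | on_chain s x) (#|x| - j)); last first.
  by rewrite sum_nat_const /passes cardsE mulnC.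
rewrite (eq_bigr (fun b => \sum_(s | on_chain s x) (b \notin prefix_set s j))); last first.
  by move=> b _; rewrite sum_bool_card.
rewrite exchange_big; apply: eq_bigr => s sx /=.
rewrite sum_bool_card (eq_card (B := x :\: prefix_set s j)); last first.
  by move=> b; rewrite !inE andbC.
rewrite cardsD (on_chainP sx) (setIidPr _) ?prefix_sub // !card_prefix //; try exact: card_set_ord.
by apply: leq_trans jx (card_set_ord _).
Qed.

Lemma leave_above x a j : a \notin x -> #|x| <= j -> j <= n ->
  #|[set s | on_chain s x && (a \in prefix_set s j)]| * (n - #|x|) = (j - #|x|) * passes x.
Proof.
move=> ax jx jn; rewrite mulnC.
have -> : n - #|x| = #|~: x| by have := cardsC x; rewrite [RHS]card_ord; lia.
rewrite -sum_nat_const.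
have -> : \sum_(b in ~: x) #|[set s | on_chain s x && (a \in prefix_set s j)]| =
          \sum_(b in ~: x) #|[set s | on_chain s x && (b \in prefix_set s j)]|.
  apply: eq_bigr => b; rewrite inE => bx.
  have tx : tperm a b @: x = x.
    apply/eqP; rewrite eqEcard card_imset ?leqnn ?andbT; last exact: perm_inj.
    apply/subsetP=> c /imsetP[c' cx ->].
    by case: tpermP => [ea|eb|//]; [rewrite -ea cx in ax | rewrite -eb cx in bx].
  rewrite -[RHS](card_permM _ (tperm a b)); apply: eq_card => s; rewrite !inE.
  rewrite -{2}tx on_chainM; congr (_ && _).
  by rewrite -[X in _ = (X \in _)](tpermL a b) prefixM mem_imset //; exact: perm_inj.
transitivity (\sum_(s | on_chain s x) (j - #|x|)); last first.
  by rewrite sum_nat_const /passes cardsE mulnC.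
rewrite (eq_bigr (fun b => \sum_(s | on_chain s x) (b \in prefix_set s j))); last first.
  by move=> b _; rewrite sum_bool_card.
rewrite exchange_big; apply: eq_bigr => s sx /=.
rewrite sum_bool_card (eq_card (B := prefix_set s j :\: x)); last first.
  by move=> b; rewrite !inE.
rewrite cardsD (on_chainP sx) (setIidPr _) ?prefix_sub // !card_prefix //; exact: card_set_ord.
Qed.

Lemma leave x a j m : j <= n -> m <= #|x| -> m <= n - #|x| ->
  #|[set s | on_chain s x && (a \in symdiff x (prefix_set s j))]| * m <=
  ((#|x| - j) + (j - #|x|)) * passes x.
Proof.
move=> jn mx mnx.
have sub s : on_chain s x -> if j <= #|x| then prefix_set s j \subset x else x \subset prefix_set s j.
  by case: leqP => jx sx; rewrite (on_chainP sx) ?prefix_sub // ltnW.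
have [jx|xj] := leqP j #|x|.
  have [ax|ax] := boolP (a \in x).
    apply: leq_trans (_ : (#|x| - j) * passes x <= _); last by rewrite leq_mul2r leq_addr orbT.
    rewrite -(leave_below ax jx) leq_mul // subset_leq_card //.
    by apply/subsetP => s; rewrite !inE ax => /andP[->]; case: (_ \in _).
  rewrite (_ : [set _ | _] = set0) ?cards0 //.
  apply/setP=> s; rewrite !inE (negbTE ax); apply/negP=> /andP[sx].
  by have := sub s sx; rewrite jx => /subsetP/(_ a); rewrite (negbTE ax); case: (_ \in _) => // ->.
have [ax|ax] := boolP (a \in x).
  rewrite (_ : [set _ | _] = set0) ?cards0 //.
  apply/setP=> s; rewrite !inE ax; apply/negP=> /andP[sx].
  by have := sub s sx; rewrite leqNgt xj => /subsetP/(_ a ax) ->.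
apply: leq_trans (_ : (j - #|x|) * passes x <= _); last by rewrite leq_mul2r leq_addl orbT.
rewrite -(leave_above ax (ltnW xj) jn) leq_mul // subset_leq_card //.
by apply/subsetP => s; rewrite !inE (negbTE ax) => /andP[->]; case: (_ \in _).
Qed.

End FullChains.

(** * The container algorithm *)

Section Containers.
Context {d : Order.disp_t} {T : finPOrderType d}.
Variables (root : T) (par : T -> T) (dist : T -> nat).
Hypothesis tree : rooted_tree root par dist.

Variable n : nat.
Local Notation V := {set 'I_n}.
Implicit Types (x y z : V) (w u v : T).

Variables (F : {set V}) (lo hi q kk Dl : nat).
Hypothesis F_band : forall x, x \in F -> lo <= #|x| <= hi.
Hypothesis q_gt0 : 0 < q.

(* The direction [b] lets one treat edges going up and down from the parent at once. *)
Definition dsub (b : bool) x y := if b then x \subset y else y \subset x.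

Lemma dsub_trans b x y z : dsub b x y -> dsub b y z -> dsub b x z.
Proof. by case: b => /= h1 h2; [apply: subset_trans h1 h2 | apply: subset_trans h2 h1]. Qed.
Lemma dsub_nested b x y : dsub b x y -> x \subset y \/ y \subset x.
Proof. by case: b; [left | right]. Qed.

Definition up w := (par w < w)%O.

(* A vertex [v] of the tree is a role that a set [z] may play.  [opts w] lists maps sending a
   set [z] in the role of [par w] to a set that can play [w] next to [z]; [bad v] collects the
   sets for which some option below [v] is missing; [cands v z] contains every set that can occur
   in the branch of [v] when [z] plays [v]; [cont] is the current container. *)
Record state := State {
  bad : T -> {set V};
  opts : T -> seq (V -> V);
  cands : T -> V -> {set V};
  cont : {set V} }.

Definition cnt st w z a := count (fun o : V -> V => a \in symdiff z (o z)) (opts st w).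

(* Genericity of [z] with respect to everything below [x] makes the image of an ancestor
   compare correctly with the images of all its descendants. *)
Definition generic st w z x :=
  [forall s in cands st w x, ~~ dsub (up w) s z && (dsub (up w) z s ==> dsub (up w) x s)].

(* Each element of the ground set separates [z] from at most two of its options; the bound
   [kk] on pairwise overlaps keeps the set of elements already used twice small, so that
   a random [x] near [z] is fresh with high probability. *)
Definition fresh st w z x :=
  [forall a in symdiff z x, cnt st w z a <= 1] &&
  (#|[set a in symdiff z x | 0 < cnt st w z a]| <= kk).

Definition eligible st w z x :=
  [&& z \in F, x \in F, z \notin bad st (par w), x \notin bad st w, dsub (up w) z x
    & q <= #|symdiff z x|].

Definition linked st w z x := [&& eligible st w z x, generic st w z x & fresh st w z x].

Definition uncovered st w (S : {set V}) : {set V} :=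
  [set z in F | (z \notin bad st (par w)) && ~~ [exists x in S, linked st w z x]].

Definition chosen st w (S : {set V}) z : V :=
  odflt set0 [pick x in S | linked st w z x].

(** One step adds one option for [w]. It is computed from the old state and [S] alone, never from
    the family that [S] was taken from; this is why the final container is a function of the
    fingerprints. *)
Definition step st w (S : {set V}) := State
  (fun v => if v == par w then bad st v :|: uncovered st w S else bad st v)
  (fun u => if u == w then chosen st w S :: opts st u else opts st u)
  (fun v z => if v == par w then cands st v z :|: cands st w (chosen st w S z) else cands st v z)
  [set x in cont st | (#|[set z in uncovered st w S | linked st w z x]| < Dl)].

Definition opt st w i : V -> V := nth id (opts st w) i.

(** Here [j] counts steps. A step at most doubles a candidate set; a fresh option moves only
    elements moved at most once before, at most [kk] of which were moved at all, and at most
    [hi - lo] elements in total. *)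
Record state_invariant (G : {set V}) (j : nat) (st : state) : Prop := Invariant {
  inv_self : forall v z, z \in cands st v z;
  inv_card : forall v z, #|cands st v z| <= 2 ^ j;
  inv_F : forall v z, z \in F -> z \notin bad st v -> cands st v z \subset F;
  inv_opt : forall w z i, w != root -> z \in F -> z \notin bad st (par w) -> i < size (opts st w) ->
    [/\ opt st w i z \in G, eligible st w z (opt st w i z), generic st w z (opt st w i z) &
        cands st w (opt st w i z) \subset cands st (par w) z];
  inv_cnt : forall w z, w != root -> z \in F -> z \notin bad st (par w) ->
    [/\ forall a, cnt st w z a <= 2, #|[set a | 1 < cnt st w z a]| <= j * kk &
        #|[set a | 0 < cnt st w z a]| <= j * (hi - lo)] }.

Definition init_state := State (fun _ => set0) (fun _ => [::]) (fun _ z => [set z]) F.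

Lemma invariant_init G : state_invariant G 0 init_state.
Proof.
split => //=.
- by move=> v z; rewrite inE.
- by move=> v z; rewrite cards1.
- by move=> v z zF _; rewrite sub1set.
- move=> w z _ _ _; rewrite !mul0n /cnt /=; split=> //; rewrite leqn0 cards_eq0;
    by apply/eqP/setP=> a; rewrite !inE.
Qed.

Lemma card_symdiff_band z x b : z \in F -> x \in F -> dsub b z x -> #|symdiff z x| <= hi - lo.
Proof.
move=> /F_band/andP[z1 z2] /F_band/andP[x1 x2].
by case: b => /= zx; [|rewrite symdiffC]; rewrite card_symdiff_sub //; apply: leq_sub.
Qed.

Lemma chosenP st w S z : z \in F -> z \notin bad st (par w) -> z \notin uncovered st w S ->
  chosen st w S z \in S /\ linked st w z (chosen st w S z).
Proof.
move=> zF zb; rewrite inE zF zb /= negbK => /existsP[x xP].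
by rewrite /chosen; case: pickP => [y /andP[]//|/(_ x)]; rewrite xP.
Qed.

Lemma par_neq w : w != root -> w != par w.
Proof. by move=> wr; apply/eqP => e; have := dist_par tree wr; rewrite -e ltnn. Qed.

(** The step enlarges [bad] and [cands] at [par w]. If [par w] had already served as an option of
    its own parent, that option could turn bad or lose its genericity; the empty list of options
    excludes this. *)
Lemma invariant_step G j st w (S : {set V}) : state_invariant G j st -> w != root -> opts st (par w) = [::] ->
  S \subset G -> state_invariant G j.+1 (step st w S).
Proof.
move=> I wr ov SG; have wv := par_neq wr.
have bad_w : bad (step st w S) w = bad st w by rewrite /= (negbTE wv).
have cands_w x : cands (step st w S) w x = cands st w x by rewrite /= (negbTE wv).
have badS u : bad st u \subset bad (step st w S) u.
  by rewrite /=; case: eqP => // _; exact: subsetUl.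
have candsS u z : cands st u z \subset cands (step st w S) u z.
  by rewrite /=; case: eqP => // _; exact: subsetUl.
have badN u z : z \notin bad (step st w S) u -> z \notin bad st u.
  by apply: contra; apply: (subsetP (badS u)).
have chP z : z \in F -> z \notin bad (step st w S) (par w) ->
    chosen st w S z \in S /\ linked st w z (chosen st w S z).
  by rewrite /= eqxx inE negb_or => zF /andP[zb zu]; exact: chosenP.
split.
- by move=> v z; apply: (subsetP (candsS v z)); exact: inv_self I v z.
- move=> v z /=; rewrite expnS mul2n -addnn; case: eqP => _.
    apply: leq_trans (leq_card_setU _ _) _; apply: leq_add; exact: inv_card I _ _.
  by apply: leq_trans (inv_card I v z) (leq_addr _ _).
- move=> v z zF zb; have zb' := badN _ _ zb.
  move: zb => /=; case: eqP => [->|_] zb; last exact: inv_F I _ _ zF zb'.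
  have [|_ /and3P[/and5P[_ xF _ xb _] _ _]] := @chP z zF; first by rewrite /= eqxx -[par w]/(par w).
  rewrite subUset (inv_F I) //=; last by move: zb; rewrite inE negb_or => /andP[].
  exact: inv_F I _ _ xF xb.
- move=> w0 z i w0r zF zb iw0; have zb' := badN _ _ zb.
  have old i' : i' < size (opts st w0) ->
    [/\ opt st w0 i' z \in G, eligible (step st w S) w0 z (opt st w0 i' z),
       generic (step st w S) w0 z (opt st w0 i' z) &
       cands (step st w S) w0 (opt st w0 i' z) \subset cands (step st w S) (par w0) z].
    move=> oo; have [h1 h2 h3 h4] := inv_opt I w0r zF zb' oo.
    have e : (w0 == par w) = false by apply/eqP => e; rewrite e ov in oo.
    split=> //; last by rewrite [X in X \subset _]/= e; exact: subset_trans h4 (candsS _ _).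
      by case/and5P: h2 => _ h _ h' h''; rewrite /eligible zF zb h /= e h' h''.
    by rewrite /generic /= e.
  move: iw0; rewrite /opt [opts _ _]/=; case: eqP => [ew|_ /old //].
  case: i => [_|i /old //]; rewrite [nth _ _ _]/=; subst w0.
  have [xS] := chP z zF zb; rewrite /linked /eligible => /and3P[/and5P[_ xF _ xb zx] gen _].
  split; first by apply: (subsetP SG).
  + by rewrite /eligible zF zb xF bad_w xb.
  + by apply/forall_inP => s; rewrite cands_w => /(forall_inP gen).
  + by rewrite cands_w /= eqxx; exact: subsetUr.
- move=> w0 z w0r zF zb; have zb' := badN _ _ zb.
  have [h1 h2 h3] := inv_cnt I w0r zF zb'.
  have [ew|new] := eqVneq w0 w; last first.
    by rewrite /cnt /= (negbTE new); split=> //; apply: leq_trans (leq_mul (leqnSn _) (leqnn _)).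
  subst w0; have [_ /and3P[/and5P[_ xF _ _ /andP[zx _]] _ /andP[/forall_inP fr1 fr2]]] := chP z zF zb.
  set x := chosen st w S z in xF zx fr1 fr2.
  have cntE a : cnt (step st w S) w z a = (a \in symdiff z x) + cnt st w z a.
    by rewrite /cnt /= eqxx.
  split.
  + move=> a; rewrite cntE; case: (boolP (a \in _)) => [/fr1|_] /=; last exact: h1.
    by rewrite add1n ltnS.
  + rewrite mulSn addnC; apply: leq_trans (leq_add h2 fr2).
    apply: leq_trans (leq_card_setU _ _); apply: subset_leq_card; apply/subsetP => a.
    rewrite inE cntE !in_setU [in X in _ || X]inE [in X in X || _]inE.
    by case: (a \in _) => /=; rewrite ?add0n ?add1n ?ltnS => ->; rewrite ?orbT.
  + rewrite mulSn addnC; apply: leq_trans (leq_add h3 (card_symdiff_band zF xF zx)).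
    apply: leq_trans (leq_card_setU _ _); apply: subset_leq_card; apply/subsetP => a.
    rewrite inE cntE in_setU [in X in X || _]inE.
    by case: (a \in _) => /=; rewrite ?add0n ?orbT // orbF.
Qed.

(** Take a largest [S] that covers at least [Dl] points of [B] per member. A further [x] with [Dl]
    uncovered neighbours could be added to it, against maximality. *)
Lemma greedy_cover (I : finType) (A B : {set I}) (r : I -> I -> bool) :
  exists S : {set I}, [/\ S \subset A, #|S| * Dl <= #|B| &
    forall x : I, x \in A -> #|[set z in B | r z x & ~~ [exists y in S, r z y]]| < Dl \/ Dl = 0].
Proof.
have [->|Dl0] := posnP Dl; first by exists set0; rewrite sub0set muln0; split=> // x _; right.
pose N (S : {set I}) := [set z in B | [exists y in S, r z y]].
pose P (S : {set I}) := (S \subset A) && (#|S| * Dl <= #|N S|).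
have P0 : P set0 by rewrite /P sub0set cards0 mul0n.
case: (arg_maxnP (fun S : {set I} => #|S|) P0) => S /andP[SA SN] Smax.
exists S; split=> //.
  by apply: leq_trans SN (subset_leq_card _); apply/subsetP => z; rewrite inE => /andP[].
move=> x xA; left; rewrite ltnNge; apply/negP => big.
have xS : x \notin S.
  apply/negP=> xS; move: big; rewrite leqNgt => /negP; apply.
  rewrite (_ : [set _ in _ | _] = set0) ?cards0 //; apply/setP=> z; rewrite !inE.
  apply/negP=> /and3P[_ rzx /existsP]; apply; by exists x; rewrite xS.
suff /Smax : P (x |: S) by rewrite cardsU1 xS add1n /= ltnn.
rewrite /P subUset sub1set xA SA /= cardsU1 xS add1n mulSn.
apply: leq_trans (leq_add big SN) _.
set A1 := [set _ in _ | _]; rewrite -(cardsUI A1 (N S)).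
have -> : A1 :&: N S = set0.
  by apply/setP=> z; rewrite !inE; apply/negP=> /andP[/and3P[_ _ /negP nz] /andP[_ /nz]].
rewrite cards0 addn0.
apply: subset_leq_card; apply/subsetP=> z; rewrite !inE => /orP[/and3P[-> rzx _]|/andP[-> /existsP[y /andP[yS ryz]]]] /=.
  by apply/existsP; exists x; rewrite !inE eqxx.
by apply/existsP; exists y; rewrite !inE yS orbT.
Qed.

Hypothesis Dl_gt0 : 0 < Dl.

Lemma fingerprint st w (G : {set V}) : G \subset cont st ->
  exists S : {set V}, [/\ S \subset G, #|S| * Dl <= #|F| & G \subset cont (step st w S)].
Proof.
move=> GC; have [S [SG SF SP]] := greedy_cover G F (linked st w).
exists S; split=> //; apply/subsetP=> x xG /=; rewrite inE (subsetP GC) //=.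
case: (SP x xG) => [lt|e]; last by move: Dl_gt0; rewrite e.
apply: leq_ltn_trans lt; apply: subset_leq_card; apply/subsetP=> z; rewrite !inE.
by case/andP=> /and3P[-> _ ->] ->.
Qed.

Fixpoint run st (L : seq T) (SS : seq {set V}) :=
  if L is w :: L' then if SS is X :: SS' then run (step st w X) L' SS' else st else st.

(* A branch must be complete before its root is used as an option. *)
Fixpoint good_order (done L : seq T) :=
  if L is w :: L' then [&& w != root, par w \notin done & good_order (w :: done) L'] else true.

Lemma fingerprints st L (G : {set V}) : G \subset cont st ->
  exists SS : seq {set V}, [/\ size SS = size L,
    (forall S, S \in SS -> S \subset G /\ #|S| * Dl <= #|F|) & G \subset cont (run st L SS)].
Proof.
elim: L st => [|w L IH] st GC; first by exists [::].
have [S [SG SF GC']] := fingerprint w GC.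
have [SS [h1 h2 h3]] := IH _ GC'.
exists (S :: SS); split=> //=; first by rewrite h1.
by move=> S'; rewrite in_cons => /orP[/eqP->|/h2].
Qed.

(** All vertices that have options are in [done], so [good_order] supplies the emptiness that
    [invariant_step] requires. *)
Lemma invariant_run G j st L (SS : seq {set V}) done : state_invariant G j st -> good_order done L ->
  (forall u, 0 < size (opts st u) -> u \in done) ->
  (forall S, S \in SS -> S \subset G) -> size SS = size L ->
  state_invariant G (j + size L) (run st L SS).
Proof.
elim: L j st SS done => [|w L IH] j st [|S SS] done I //=; first by rewrite addn0.
case/and3P=> wr pd go od SG [sz].
rewrite addnS -addSn; apply: (IH _ _ _ (w :: done)) => //.
- apply: invariant_step => //; last by apply: SG; rewrite in_cons eqxx.
  by apply/size0nil/eqP; rewrite -leqn0 leqNgt; apply: contra pd => /od.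
- move=> u /=; rewrite in_cons; case: eqP => //= _; exact: od.
- by move=> S' S'SS; apply: SG; rewrite in_cons S'SS orbT.
Qed.

Lemma size_opts_run st L SS w : size SS = size L ->
  size (opts (run st L SS) w) = size (opts st w) + count_mem w L.
Proof.
elim: L st SS => [|v L IH] st [|S SS] //=; first by rewrite addn0.
move=> [sz]; rewrite IH //= eq_sym; case: eqP => //= _; lia.
Qed.

Lemma cont_run st L SS : cont (run st L SS) \subset cont st.
Proof.
elim: L st SS => [|v L IH] st [|S SS] //=.
by apply: subset_trans (IH _ _) _; apply/subsetP=> x /=; rewrite inE => /andP[].
Qed.

End Containers.

(** * Size of the containers *)

Lemma card_le_sum (I J : finType) (P : pred I) (K : {set J}) (Q : J -> pred I) :
  (forall i, P i -> exists2 s, s \in K & Q s i) ->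
  #|[set i | P i]| <= \sum_(s in K) #|[set i | Q s i]|.
Proof.
move=> PQ; have sub : [set i | P i] \subset \bigcup_(s in K) [set i | Q s i].
  apply/subsetP=> i; rewrite inE => /PQ[s sK Qs].
  by apply/bigcupP; exists s; rewrite ?inE.
apply: leq_trans (subset_leq_card sub) _.
elim/big_rec2: _ => [|s a b _ IH]; first by rewrite cards0.
by apply: leq_trans (leq_card_setU _ _) _; rewrite leq_add2l.
Qed.

Lemma prefix_pred n (s : {perm 'I_n}) (x : {set 'I_n}) :
  prefix_set s #|x|.-1 = x -> x = set0.
Proof.
move=> e; have : #|prefix_set s #|x|.-1| = #|x| by rewrite e.
rewrite card_prefix; last exact: leq_trans (leq_pred _) (card_set_ord x).
case E: #|x| => [|c] /=; first by move=> _; apply: cards0_eq.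
by move/eqP; rewrite ltn_eqF.
Qed.

Lemma prefix_succ n (s : {perm 'I_n}) (x : {set 'I_n}) :
  #|x| < n -> prefix_set s #|x|.+1 <> x.
Proof.
move=> lt e; have : #|prefix_set s #|x|.+1| = #|x| by rewrite e.
by rewrite card_prefix // => /eqP; rewrite gtn_eqF.
Qed.

Section ChainBound.
Context {d : Order.disp_t} {T : finPOrderType d}.
Variables (root : T) (par : T -> T) (dist : T -> nat).
Hypothesis tree : rooted_tree root par dist.

Variable n : nat.
Local Notation V := {set 'I_n}.
Implicit Types (x y z : V) (w u v : T) (s : {perm 'I_n}).

Variables (F : {set V}) (lo hi q kk Dl m : nat).
Hypothesis F_band : forall x, x \in F -> lo <= #|x| <= hi.
Hypothesis q_gt0 : 0 < q.
Hypothesis hi_le : hi <= n.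
Hypothesis m_lo : m <= lo.
Hypothesis m_hi : m <= n - hi.

Local Notation state := (@state _ T n).
Local Notation step := (step par F q kk Dl).
Local Notation linked := (linked par F q kk).
Local Notation eligible := (eligible par F q).
Local Notation uncovered := (uncovered par F q kk).

Lemma F_m x : x \in F -> m <= #|x| /\ m <= n - #|x|.
Proof. by move/F_band=> /andP[h1 h2]; split; move: m_lo m_hi; lia. Qed.

Definition deviates s x (a : 'I_n) := [exists z in F, on_chain s z && (a \in symdiff x z)].

(** All sets of [F] on the chain lie between its levels [lo] and [hi]. Hence if one of them
    disagrees with [x] on [a], then so does the set at level [lo] or the one at level [hi], and the
    two bounds of [leave] add up to [hi - lo]. *)
Lemma card_deviates x a : x \in F ->
  #|[set s | on_chain s x && deviates s x a]| * m <= (hi - lo) * passes x.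
Proof.
move=> xF; have [mx mnx] := F_m xF; have /andP[lx xh] := F_band xF.
have lon : lo <= n by move: hi_le; lia.
have := leave a lon mx mnx; have := leave a hi_le mx mnx.
set A := [set _ | _]; set B := [set _ | _] => hA hB.
apply: (@leq_trans (#|A| * m + #|B| * m)).
  rewrite -mulnDl leq_mul2r; apply/orP; right; apply: leq_trans (leq_card_setU _ _).
  apply: subset_leq_card; apply/subsetP=> s; rewrite !inE => /andP[sx /existsP[z /and3P[zF sz]]].
  have /andP[lz zh] := F_band zF; rewrite sx inE /=.
  have [zx|/ltnW xz] := leqP #|z| #|x|.
    have sub := on_chain_sub sz sx zx => az; apply/orP; right.
    move: az; have := subsetP sub a; have : prefix_set s lo \subset z.
      by rewrite (on_chainP sz) prefix_sub.
    by move/subsetP/(_ a); case: (a \in z); case: (a \in x); case: (a \in prefix_set s lo) => // h1 h2;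
       try (by have := h1 isT); try (by have := h2 isT).
  have sub := on_chain_sub sx sz xz => az; apply/orP; left.
  move: az; have := subsetP sub a; have : z \subset prefix_set s hi.
    by rewrite (on_chainP sz) prefix_sub.
  by move/subsetP/(_ a); case: (a \in z); case: (a \in x); case: (a \in prefix_set s hi) => // h1 h2;
     try (by have := h1 isT); try (by have := h2 isT).
apply: leq_trans (leq_add hA hB) _; rewrite -mulnDl leq_mul2r; apply/orP; right; lia.
Qed.

Variables (G : {set V}) (j : nat) (st : state) (w : T).
Hypothesis I : state_invariant root par F lo hi q kk G j st.
Hypothesis w_root : w != root.

Lemma card_bad_cover (S : {set V}) x : x \in cont (step st w S) ->
  #|[set s | on_chain s x && [exists z in uncovered st w S, on_chain s z && linked st w z x]]| * m ^ q
    <= Dl * (q`! * passes x).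
Proof.
rewrite /= inE => /andP[_ lt].
set U := [set z in uncovered st w S | linked st w z x] in lt *.
have h := @card_le_sum _ _ (fun s => on_chain s x && [exists z in uncovered st w S, on_chain s z && linked st w z x])
   U (fun z s => on_chain s z && on_chain s x).
apply: leq_trans (leq_mul (h _) (leqnn _)) _.
  by move=> s /andP[sx /existsP[z /and3P[zU sz r]]]; exists z; rewrite ?sz // inE zU.
rewrite big_distrl /=; apply: (@leq_trans (#|U| * (q`! * passes x))); last first.
  by rewrite leq_mul2r (ltnW lt) orbT.
rewrite -sum_nat_const; apply: leq_sum => z; rewrite !inE.
case/andP=> _ /and3P[/and5P[zF _ _ _ /andP[/dsub_nested zx qg]] _ _].
by have [mz mnz] := F_m zF; exact: passes2_le.
Qed.

(** Take [z] below [x]; the other direction is symmetric. A candidate [t] fails in two ways. If [t]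
    lies inside [z], the chain enters [x] by adding an element of [x] outside [t]: at most [hi - lo]
    elements, each with probability at most 1/m. If [z] lies inside [t] but [x] does not, [z] misses
    a fixed element of [x] outside [t], which [card_deviates] bounds. *)
Lemma card_bad_generic x : x \in F ->
  #|[set s | on_chain s x && [exists z in F, [&& on_chain s z, eligible st w z x & ~~ generic par st w z x]]]| * m
    <= 2 ^ j * ((hi - lo).*2 * passes x).
Proof.
move=> xF; have [xb|xb] := boolP (x \in bad st w).
  rewrite (_ : [set _ | _] = set0) ?cards0 //; apply/setP=> s; rewrite !inE.
  by apply/negP=> /andP[_ /existsP[z /and4P[_ _ /and5P[_ _ _]]]]; rewrite xb.
have [mx mnx] := F_m xF; have KF := inv_F I xF xb.
(* The level next to [x] on the side of [z], so the chain passes it between [z] and [x]. *)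
pose j0 := if up par w then #|x|.-1 else #|x|.+1.
pose Qe (e : 'I_n) s := on_chain s x && (e \in symdiff x (prefix_set s j0)).
pose Q1 t s := [&& on_chain s x, dsub (up par w) t x & [exists e in symdiff x t, e \in symdiff x (prefix_set s j0)]]
   && (j0 <= n).
(* The element is chosen from [x] and [t] only, before the chain is known, so no union over elements
   is paid. *)
pose c (t : V) := [pick a in (if up par w then x :\: t else t :\: x)].
pose Q2 t s := on_chain s x && (if c t is Some a then deviates s x a else false).
set P := fun _ => _.
have h := @card_le_sum _ _ P (cands st w x) (fun t s => Q1 t s || Q2 t s).
apply: leq_trans (leq_mul (h _) (leqnn _)) _; rewrite /P {h}.
- move=> s /andP[sx /existsP[z /and4P[zF sz el]]].
  case/and5P: el => _ _ _ _ /andP[zx qg].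
  rewrite negb_forall_in => /existsP[t /andP[tK]]; rewrite negb_and negbK => ng; exists t => //.
  have neq : x != z.
    apply: contraTneq qg => <-; rewrite -ltnNge (_ : symdiff x x = set0) ?cards0 //.
    by apply/setP=> a; rewrite !inE eqxx.
  have zn := card_set_ord z; have xn := card_set_ord x.
  have cxz : j0 <= n /\ dsub (up par w) z (prefix_set s j0).
    rewrite /j0; case: (up par w) zx => /= zx; have czx := subset_leq_card zx.
    - split; first by apply: leq_trans (leq_pred _) xn.
      have lt : #|z| < #|x| by rewrite ltn_neqAle czx andbT; apply: contraNneq neq => e; rewrite eq_sym eqEcard zx e leqnn.
      by rewrite (on_chainP sz) prefix_sub // -ltnS prednK // (leq_ltn_trans _ lt).
    - have lt : #|x| < #|z| by rewrite ltn_neqAle czx andbT; apply: contraNneq neq => e; rewrite eqEcard zx e leqnn.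
      by split; [exact: leq_trans lt zn | rewrite (on_chainP sz) prefix_sub].
  case: cxz => j0n zj0.
  case/orP: ng => [tz|].
  + apply/orP; left; rewrite /Q1 sx (dsub_trans tz zx) j0n /= andbT.
    have : prefix_set s j0 != x.
      apply/eqP; move: j0n; rewrite /j0; case: (up par w) zx => /= zx j0n; last exact: prefix_succ.
      by move/prefix_pred => x0; move: zx neq; rewrite x0 subset0 eq_sym => ->.
    move=> ne; have [e eP] : exists e, e \in symdiff x (prefix_set s j0).
      apply/set0Pn; apply: contraNneq ne => e0; apply/eqP/setP=> a.
      by have := in_set0 a; rewrite -e0 inE => /negbFE/eqP ->.
    apply/existsP; exists e; rewrite eP andbT; move: eP.
    have := dsub_trans tz zj0; have : dsub (up par w) (prefix_set s j0) x.
      rewrite (on_chainP sx) /j0; case: (up par w) => /=; apply: prefix_sub;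
        [exact: leq_pred | exact: leqnSn].
    rewrite !inE; case: (up par w) => /= /subsetP/(_ e) h1 /subsetP/(_ e) h2;
    by move: h1 h2; case: (e \in x); case: (e \in t); case: (e \in prefix_set _ _) => // h1 h2;
     try (by have := h1 isT); try (by have := h2 isT).
  + rewrite negb_imply => /andP[zt xt]; apply/orP; right; rewrite /Q2 sx /c; case: pickP => [a aP|none].
      apply/existsP; exists z; rewrite zF sz /= inE; move: aP zt {xt}.
      by case: (up par w) => /=; rewrite inE => /andP[a1 a2] /subsetP/(_ a); rewrite ?(negbTE a1) a2; case: (a \in z) => // h; have := h isT; rewrite ?(negbTE a1).
    by move: xt; case: (up par w) none => none /= /negP[]; apply/subsetP=> a ax;
       have := none a; rewrite inE ax andbT => /negbFE.
- rewrite big_distrl /=; apply: (@leq_trans (#|cands st w x| * ((hi - lo).*2 * passes x))); last first.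
    by rewrite leq_mul2r (inv_card I) orbT.
  rewrite -sum_nat_const; apply: leq_sum => t tK; have tF := subsetP KF t tK.
  rewrite -addnn mulnDl.
  apply: (@leq_trans (#|[set s | Q1 t s]| * m + #|[set s | Q2 t s]| * m)).
    rewrite -mulnDl leq_mul2r; apply/orP; right; apply: leq_trans (leq_card_setU _ _).
    by apply: subset_leq_card; apply/subsetP=> s; rewrite !inE.
  apply: leq_add.
  + have [tx|tx] := boolP (dsub (up par w) t x); last first.
      rewrite (_ : [set _ | _] = set0) ?cards0 //; apply/setP=> s; rewrite !inE /Q1 (negbTE tx).
      by rewrite !andbF.
    have [j0n|j0n] := boolP (j0 <= n); last first.
      rewrite (_ : [set _ | _] = set0) ?cards0 //; apply/setP=> s; rewrite !inE /Q1 (negbTE j0n).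
      by rewrite !andbF.
    have h := @card_le_sum _ _ (Q1 t) (symdiff x t) Qe.
    apply: leq_trans (leq_mul (h _) (leqnn _)) _.
      by move=> s /andP[/and3P[sx _ /existsP[e /andP[e1 e2]]] _]; exists e => //; rewrite /Qe sx.
    rewrite big_distrl /=; apply: (@leq_trans (#|symdiff x t| * passes x)); last first.
      by rewrite leq_mul2r symdiffC (card_symdiff_band F_band tF xF tx) orbT.
    rewrite -sum_nat_const; apply: leq_sum => e _.
    apply: leq_trans (leave e j0n mx mnx) _.
    rewrite -[X in _ <= X]mul1n leq_mul2r; apply/orP; right; rewrite /j0; case: (up par w); lia.
  + rewrite /Q2; case: (c t) => [a|]; first exact: card_deviates.
    by rewrite (_ : [set _ | _] = set0) ?cards0 //; apply/setP=> s; rewrite !inE andbF.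
Qed.

(** Elements already moved twice are few, so a union bound over them with [card_deviates] suffices.
    For the overlap, Markov's inequality is applied to the number of already moved elements on which
    the chain deviates from [z]. *)
Lemma card_bad_fresh z : z \in F ->
  #|[set s | on_chain s z && [exists x in F, [&& on_chain s x, eligible st w z x & ~~ fresh kk st w z x]]]| * (m * kk)
    <= (j * kk * kk * (hi - lo) + j * (hi - lo) * (hi - lo)) * passes z.
Proof.
move=> zF; have [zb|zb] := boolP (z \in bad st (par w)).
  rewrite (_ : [set _ | _] = set0) ?cards0 //; apply/setP=> s; rewrite !inE.
  by apply/negP=> /andP[_ /existsP[x /and4P[_ _ /and5P[_ _]]]]; rewrite zb.
have [_ c1 c2] := inv_cnt I w_root zF zb.
set A2 := [set a | _] in c1; set A1 := [set a | _] in c2.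
pose Q2 s := on_chain s z && [exists a in A2, deviates s z a].
pose Q1 s := on_chain s z && (kk < #|[set a in A1 | deviates s z a]|).
apply: (@leq_trans (#|[set s | Q2 s]| * (m * kk) + #|[set s | Q1 s]| * (m * kk))).
  rewrite -mulnDl leq_mul2r; apply/orP; right; apply: leq_trans (leq_card_setU _ _).
  apply: subset_leq_card; apply/subsetP=> s; rewrite !inE /Q1 /Q2.
  case/andP=> -> /existsP[x /and4P[xF sx _]] /=; rewrite /fresh negb_and => /orP[|big].
    rewrite negb_forall_in => /existsP[a /andP[ax]]; rewrite -ltnNge => ca.
    apply/orP; left; apply/existsP; exists a; rewrite inE ca.
    by apply/existsP; exists x; rewrite xF sx.
  apply/orP; right; rewrite -ltnNge in big; apply: leq_trans big _.
  apply: subset_leq_card; apply/subsetP=> a; rewrite !inE => /andP[ax ->] /=.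
  by apply/existsP; exists x; rewrite xF sx inE.
rewrite mulnDl; apply: leq_add.
  have h := @card_le_sum _ _ Q2 A2 (fun a s => on_chain s z && deviates s z a).
  apply: leq_trans (leq_mul (h _) (leqnn _)) _.
    by move=> s /andP[sz /existsP[a /andP[a2 da]]]; exists a; rewrite ?sz.
  rewrite mulnA big_distrl /=.
  apply: (@leq_trans (#|A2| * ((hi - lo) * passes z) * kk)).
    rewrite leq_mul2r; apply/orP; right; rewrite -sum_nat_const; apply: leq_sum => a _.
    exact: card_deviates.
  rewrite mulnAC -mulnA mulnA -[X in _ <= X]mulnA leq_mul2r; apply/orP; right.
  by rewrite leq_mul2r c1 orbT.
rewrite mulnCA.
apply: (@leq_trans (m * \sum_(a in A1) #|[set s | on_chain s z && deviates s z a]|)).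
  rewrite leq_mul2l; apply/orP; right.
  apply: (@leq_trans (\sum_(s | Q1 s) kk)); first by rewrite sum_nat_const cardsE.
  under [X in _ <= X]eq_bigr => a _ do rewrite -sum_bool_card.
  rewrite exchange_big /= [X in _ <= X](bigID (fun s => kk < #|[set a in A1 | deviates s z a]|)) /=.
  apply: leq_trans (leq_addr _ _); apply: leq_sum => s /andP[sz lt].
  by rewrite sum_bool_card; exact: ltnW.
rewrite big_distrr /=; apply: (@leq_trans (#|A1| * ((hi - lo) * passes z))).
  by rewrite -sum_nat_const; apply: leq_sum => a _; rewrite mulnC; exact: card_deviates.
by rewrite mulnA leq_mul2r leq_mul2r c2 !orbT.
Qed.

End ChainBound.

(** * Unspoiled points of a chain and the size of a container *)

Section ChainRun.
Context {d : Order.disp_t} {T : finPOrderType d}.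
Variables (root : T) (par : T -> T) (dist : T -> nat).
Hypothesis tree : rooted_tree root par dist.

Variable n : nat.
Local Notation V := {set 'I_n}.
Implicit Types (x y z : V) (w u v : T) (s : {perm 'I_n}).

Variables (F : {set V}) (lo hi q kk Dl m : nat).
Hypothesis F_band : forall x, x \in F -> lo <= #|x| <= hi.
Hypothesis q_gt0 : 0 < q.
Hypothesis hi_le : hi <= n.
Hypothesis m_lo : m <= lo.
Hypothesis m_hi : m <= n - hi.
Hypothesis m_gt0 : 0 < m.
Hypothesis kk_gt0 : 0 < kk.

Local Notation state := (@state _ T n).
Local Notation step := (step par F q kk Dl).
Local Notation run := (run par F q kk Dl).
Local Notation linked := (linked par F q kk).
Local Notation eligible := (eligible par F q).
Local Notation uncovered := (uncovered par F q kk).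

Variable R : realFieldType.

(* The four terms bound the probability that a point of a random full chain is spoiled because of
   an uncovered point, a non-generic point, an element used twice, and a large overlap. *)
Definition spoil (j : nat) : R :=
  (Dl * q`!)%:R / (m ^ q)%:R + (2 ^ j.+1 * (hi - lo))%:R / m%:R
  + (j * kk * (hi - lo))%:R / m%:R + (j * (hi - lo) * (hi - lo))%:R / (m * kk)%:R.

Lemma spoil_mono i j : i <= j -> (spoil i <= spoil j)%R.
Proof.
move=> ij; rewrite /spoil !lerD // ler_wpM2r ?invr_ge0 ?ler0n // ler_nat !leq_mul //.
by rewrite leq_pexp2l.
Qed.

(** The first two events concern [x] in the role of [w], the third [x] in the role of [par w]: each
    event is attached to the set given which it is improbable. *)
Definition spoiled st w (S : {set V}) x s :=
  [|| [exists z in uncovered st w S, on_chain s z && linked st w z x],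
      [exists z in F, [&& on_chain s z, eligible st w z x & ~~ generic par st w z x]]
    | [exists z in F, [&& on_chain s z, eligible st w x z & ~~ fresh kk st w x z]]].

Lemma spoiled_rare (G : {set V}) j st w (S : {set V}) x :
  state_invariant root par F lo hi q kk G j st -> w != root ->
  x \in F -> x \in cont (step st w S) ->
  ((#|[set s | on_chain s x && spoiled st w S x s]|)%:R <= spoil j * (passes x)%:R)%R.
Proof.
move=> I wr xF xC.
have h1 := card_bad_cover F_band q_gt0 hi_le m_lo m_hi xC.
have h2 := card_bad_generic F_band q_gt0 hi_le m_lo m_hi I wr xF.
have h3 := card_bad_fresh F_band q_gt0 hi_le m_lo m_hi I wr xF.
move: h1 h2 h3; set A1 := #|_|; set A2 := #|_|; set A3 := #|_| => h1 h2 h3.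
have le : #|[set s | on_chain s x && spoiled st w S x s]| <= A1 + A2 + A3.
  rewrite /A1 /A2 /A3.
  apply: leq_trans (leq_add (leq_card_setU _ _) (leqnn _)).
  apply: leq_trans (leq_card_setU _ _); apply: subset_leq_card; apply/subsetP=> s.
  by rewrite !inE => /andP[->] /or3P[] /= ->; rewrite ?orbT.
have mq : 0 < m ^ q by rewrite expn_gt0 m_gt0.
apply: (@le_trans _ _ (A1%:R + A2%:R + A3%:R)%R); first by rewrite -!natrD ler_nat.
have k1 : (A1%:R <= (Dl * q`!)%:R / (m ^ q)%:R * (passes x)%:R :> R)%R.
  by rewrite mulrAC ler_pdivlMr ?ltr0n // -!natrM ler_nat -mulnA.
have k2 : (A2%:R <= (2 ^ j.+1 * (hi - lo))%:R / m%:R * (passes x)%:R :> R)%R.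
  rewrite mulrAC ler_pdivlMr ?ltr0n // -!natrM ler_nat; apply: leq_trans h2 _.
  by rewrite -mul2n expnS; lia.
have k3 : (A3%:R <= ((j * kk * (hi - lo))%:R / m%:R + (j * (hi - lo) * (hi - lo))%:R / (m * kk)%:R) * (passes x)%:R :> R)%R.
  have mkk : 0 < m * kk by rewrite muln_gt0 m_gt0.
  have -> : ((j * kk * (hi - lo))%:R / m%:R = (j * kk * kk * (hi - lo))%:R / (m * kk)%:R :> R)%R.
    rewrite !natrM; field; rewrite !pnatr_eq0; lia.
  by rewrite -mulrDl mulrAC ler_pdivlMr ?ltr0n // -natrD -!natrM ler_nat.
move: k1 k2 k3; rewrite /spoil !mulrDl; lra.
Qed.

(** [B] collects the spoiling events of all steps. If vertices of [T] sit at unspoiled points of a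
    chain, no step makes one of them bad: were [y (par w)] uncovered, it would be linked to [y w],
    since genericity and freshness are not spoiled, and then [y w] itself would be spoiled by an
    uncovered neighbour. *)
Lemma spoil_run (G : {set V}) j st L (SS : seq {set V}) done (C : {set V}) r :
  state_invariant root par F lo hi q kk G j st -> good_order root par done L ->
  (forall u, 0 < size (opts st u) -> u \in done) ->
  (forall S, S \in SS -> S \subset G) -> size SS = size L -> j + size L <= r ->
  C \subset F -> C \subset cont (run st L SS) ->
  exists B : V -> pred {perm 'I_n},
    (forall x, x \in C -> ((#|[set s | on_chain s x && B x s]|)%:R <= (size L)%:R * spoil r * (passes x)%:R)%R) /\
    forall s (y : T -> V), (forall u, [/\ y u \in C, on_chain s (y u) & ~~ B (y u) s]) ->
      (forall w, w != root -> dsub (up par w) (y (par w)) (y w) /\ q <= #|symdiff (y (par w)) (y w)|) ->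
      (forall u, y u \notin bad st u) -> forall u, y u \notin bad (run st L SS) u.
Proof.
elim: L j st SS done => [|w L IH] j st [|S SS] done I //=.
  move=> _ _ _ _ _ _ _; exists (fun _ _ => false); split=> // x xC.
  rewrite mul0r mul0r (_ : [set _ | _] = set0) ?cards0 //.
  by apply/setP=> s; rewrite !inE andbF.
case/and3P=> wr pd go od SG [sz] jr CF CC.
have oS u : 0 < size (opts (step st w S) u) -> u \in w :: done.
  by rewrite /= in_cons; case: eqP => //= _; exact: od.
have I' : state_invariant root par F lo hi q kk G j.+1 (step st w S).
  apply: (invariant_step tree Dl F_band I) => //; last by apply: SG; rewrite in_cons eqxx.
  by apply/size0nil/eqP; rewrite -leqn0 leqNgt; apply: contra pd => /od.
have SG' S' : S' \in SS -> S' \subset G by move=> h; apply: SG; rewrite in_cons h orbT.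
have jr' : j.+1 + size L <= r by rewrite addSn -addnS.
have [B [B1 B2]] := IH _ _ SS (w :: done) I' go oS SG' sz jr' CF CC.
have CS : C \subset cont (step st w S) := subset_trans CC (cont_run _ _ _ _ _ _ _ _).
exists (fun x s => spoiled st w S x s || B x s); split.
  move=> x xC.
  have r1 := spoiled_rare I wr (subsetP CF x xC) (subsetP CS x xC).
  have r2 : (spoil j <= spoil r)%R by apply: spoil_mono; lia.
  have r3 := B1 x xC.
  have r4 : (#|[set s | on_chain s x && (spoiled st w S x s || B x s)]|%:R <=
    #|[set s | on_chain s x && spoiled st w S x s]|%:R + #|[set s | on_chain s x && B x s]|%:R :> R)%R.
    rewrite -natrD ler_nat; apply: leq_trans (leq_card_setU _ _); apply: subset_leq_card.
    by apply/subsetP=> s; rewrite !inE => /andP[->].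
  have p0 : (0 <= (passes x)%:R :> R)%R by [].
  have := ler_wpM2r p0 r2; rewrite -natr1; nra.
move=> s y yP ygap ybad; apply: (B2 s) => // u.
  by have [h1 h2] := yP u; rewrite negb_or => /andP[].
rewrite /=; case: eqP => [eu|//]; rewrite in_setU negb_or eu ybad /=.
have [yvC yvs] := yP (par w); rewrite negb_or /spoiled !negb_or => /andP[/and3P[_ _ b3] _].
have [ywC yws] := yP w; rewrite negb_or /spoiled !negb_or => /andP[/and3P[b1 b2 _] _].
have [g1 g2] := ygap w wr.
have el : eligible st w (y (par w)) (y w).
  by rewrite /eligible (subsetP CF _ yvC) (subsetP CF _ ywC) !ybad g1 g2.
apply: contra b1 => yU; apply/existsP; exists (y (par w)); rewrite yU yvs /linked el /=.
apply/andP; split.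
  by apply: contraNT b2 => ng; apply/existsP; exists (y (par w)); rewrite (subsetP CF _ yvC) yvs el.
by apply: contraNT b3 => ng; apply/existsP; exists (y w); rewrite (subsetP CF _ ywC) yws el.
Qed.

(* A chain that meets [C] in more than [q * k.-1] unspoiled points has [k] of them
   spaced by [q] levels; placed according to [level] they make every edge of [T]
   eligible, so none of them is bad. *)
Lemma spaced_points (A : {set V}) s k : (forall u, level u < k) ->
  {in A, forall x, on_chain s x} -> q * k.-1 < #|A| ->
  exists y : T -> V, (forall u, y u \in A) /\ forall w, w != root -> dsub (up par w) (y (par w)) (y w) /\ q <= #|symdiff (y (par w)) (y w)|.
Proof.
move=> lev As cA.
pose r (x y : V) := #|x| <= #|y|.
pose sA := sort r (enum A).
have szA : size sA = #|A| by rewrite size_sort -cardE.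
have memA x : (x \in sA) = (x \in A) by rewrite mem_sort mem_enum.
have inj : {in A &, injective (fun x : V => #|x|)}.
  by move=> x y xA yA /= e; rewrite (on_chainP (As x xA)) (on_chainP (As y yA)) e.
have incr i j : i < j -> j < #|A| -> #|nth set0 sA i| + (j - i) <= #|nth set0 sA j|.
  have step1 i' : i'.+1 < #|A| -> #|nth set0 sA i'| < #|nth set0 sA i'.+1|.
    move=> lt; have srt : sorted r sA by apply: sort_sorted => x y; exact: leq_total.
    have le : r (nth set0 sA i') (nth set0 sA i'.+1).
      by apply: (sorted_ltn_nth (leT := r)) => //; rewrite ?inE ?szA //; [move=> a b c; apply: leq_trans | exact: ltnW].
    rewrite ltn_neqAle; apply/andP; split=> //; apply/eqP=> /inj; rewrite -!memA !mem_nth ?szA //; last exact: ltnW.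
    move=> /(_ isT isT)/eqP; rewrite nth_uniq ?szA //; [by rewrite ltn_eqF | exact: ltnW | by rewrite sort_uniq enum_uniq].
  move=> ij; rewrite -(subnKC ij); elim: (j - i.+1) => [|e IH] lt.
    by rewrite addn0 subSnn addn1; apply: step1; rewrite addn0 in lt.
  rewrite addnS subSn; last by lia.
  rewrite addnS; apply: leq_ltn_trans (IH _) (step1 _ _); lia.
have ltA u : q * level u < #|A|.
  by apply: leq_ltn_trans cA; rewrite leq_mul2l; apply/orP; right; have := lev u; lia.
exists (fun u => nth set0 sA (q * level u)); split.
  by move=> u; rewrite -memA mem_nth // szA.
have edge u v : (u < v)%O -> nth set0 sA (q * level u) \subset nth set0 sA (q * level v) /\
    q <= #|nth set0 sA (q * level v)| - #|nth set0 sA (q * level u)|.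
  move=> /level_lt uv.
  have lt : q * level u < q * level v by rewrite ltn_pmul2l.
  have := incr _ _ lt (ltA v); rewrite -mulnBr => h.
  have h' : q <= q * (level v - level u) by rewrite leq_pmulr // subn_gt0.
  split; last by lia.
  by apply: (on_chain_sub (s := s)); rewrite ?As -?memA ?mem_nth ?szA //; lia.
move=> w wr; have [_ _ cov _] := tree.
rewrite /up; case/orP: (cov w wr) => /covers_lt lt; have [e1 e2] := edge _ _ lt.
  by rewrite lt_gtF //= symdiffC card_symdiff_sub.
by rewrite lt /= card_symdiff_sub.
Qed.

(** More than [q * k.-1] unspoiled points on one chain would place [root] at a point that is not
    bad, but [C] consists of points bad for [root]. Averaging over all chains, with spoiled points a
    small fraction of all incidences, gives an LYM-type bound. *)
Lemma card_container L (SS : seq {set V}) k (C : {set V}) :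
  (forall u, level u < k) -> good_order root par [::] L -> size SS = size L ->
  C \subset cont (run (@init_state _ T n F) L SS) -> C \subset bad (run (@init_state _ T n F) L SS) root ->
  ((#|C|)%:R * (1 - (size L)%:R * spoil (size L)) <= ('C(n, n./2) * (q * k.-1))%:R)%R.
Proof.
move=> lev go sz CC Cb.
have CF : C \subset F by apply: subset_trans CC _; exact: (cont_run _ _ _ _ _ (@init_state _ T n F)).
have I := invariant_init root par F lo hi q kk setT.
have [||||B [B1 B2]] := spoil_run (C := C) (r := size L) I go _ (fun S _ => subsetT S) sz => //.
set e := (_%:R * spoil _)%R in B1 *.
pose W := \sum_(x in C) passes x.
have few s : #|[set x in C | on_chain s x && ~~ B x s]| <= q * k.-1.
  rewrite leqNgt; apply/negP=> big.
  have [y [yA ygap]] := spaced_points lev (s := s) (A := [set x in C | on_chain s x && ~~ B x s])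
    (fun x => ltac:(by rewrite inE => /and3P[])) big.
  have yP u : [/\ y u \in C, on_chain s (y u) & ~~ B (y u) s].
    by have := yA u; rewrite inE => /and3P[].
  have [yr _ _] := yP root.
  have := B2 s y yP ygap (fun u => ltac:(by rewrite /= inE)) root.
  by rewrite (subsetP Cb _ yr).
have WE : W = \sum_s #|[set x in C | on_chain s x]|.
  rewrite /W; under eq_bigr => x _ do rewrite /passes -sum1dep_card big_mkcond.
  by rewrite exchange_big; apply: eq_bigr => s _; rewrite -sum1dep_card -big_mkcondr.
have W1 : (W%:R <= (n`! * (q * k.-1))%:R + e * W%:R)%R.
  have -> : n`! * (q * k.-1) = \sum_(s : {perm 'I_n}) q * k.-1.
    rewrite sum_nat_const -[in LHS](card_ord n) -cardsT -card_perm; congr (_ * _).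
    by apply: eq_card => s; rewrite [RHS](_ : _ = true) //; apply/subsetP=> a _; rewrite inE.
  have le : W <= \sum_(s : {perm 'I_n}) q * k.-1 + \sum_(x in C) #|[set s | on_chain s x && B x s]|.
    have -> : \sum_(x in C) #|[set s | on_chain s x && B x s]| = \sum_s #|[set x in C | on_chain s x && B x s]|.
      under eq_bigr => x _ do rewrite -sum1dep_card big_mkcond.
      by rewrite exchange_big; apply: eq_bigr => s _; rewrite -sum1dep_card -big_mkcondr.
    rewrite WE -big_split; apply: leq_sum => s _.
    apply: leq_trans (leq_add (few s) (leqnn _)).
    apply: leq_trans (leq_card_setU _ _); apply: subset_leq_card; apply/subsetP=> x.
    by rewrite !inE => /andP[-> ->]; case: (B x s).
  apply: (@le_trans _ _ ((\sum_(s : {perm 'I_n}) q * k.-1 + \sum_(x in C) #|[set s | on_chain s x && B x s]|)%:R)%R).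
    by rewrite ler_nat.
  by rewrite natrD lerD2l /W !natr_sum mulr_sumr; apply: ler_sum => x; exact: B1.
(* A random chain meets a given set with probability at least 1 / C(n, n/2), as the middle layer is
   the largest. *)
have W2 : #|C| * n`! <= 'C(n, n./2) * W.
  rewrite -sum_nat_const /W big_distrr; apply: leq_sum => x _.
  by rewrite -(passes_bin x) mulnC leq_mul2r; apply/orP; right; exact: bin_half_max.
have [e1|e1] := lerP 1%R e.
  apply: (@le_trans _ _ 0%R) => //; rewrite mulr_ge0_le0 ?ler0n //; lra.
have f0 : (0 < (n`!)%:R :> R)%R by rewrite ltr0n fact_gt0.
rewrite -(ler_pM2r f0).
apply: (@le_trans _ _ ((('C(n, n./2) * W)%:R) * (1 - e))%R).
  by rewrite mulrAC ler_wpM2r -?natrM ?ler_nat //; lra.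
rewrite !natrM -!mulrA; apply: ler_wpM2l => //.
move: W1; rewrite !natrM; lra.
Qed.

End ChainRun.

(** * Embedding the tree *)

Section Embedding.
Context {d : Order.disp_t} {T : finPOrderType d}.
Variables (root : T) (par : T -> T) (dist : T -> nat).
Hypothesis tree : rooted_tree root par dist.

Lemma tree_ind (P : T -> Prop) :
  P root -> (forall w, w != root -> P (par w) -> P w) -> forall u, P u.
Proof.
move=> P0 PS u; move: {2}(dist u) (leqnn (dist u)) => m.
elim: m u => [|m IH] u du.
  by have [->//|/(dist_par tree)] := eqVneq u root; move: du; lia.
have [->//|ur] := eqVneq u root; apply: PS => //; apply: IH.
have := dist_par tree ur; move: du; lia.
Qed.

Lemma anc_rootE w : anc par w root -> w = root.
Proof. by move=> a; apply: (anc_antisym tree) => //; exact: (anc_root tree). Qed.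

Variable n : nat.
Local Notation V := {set 'I_n}.
Implicit Types (x z : V) (w u v y : T).

Variables (F : {set V}) (lo hi q kk : nat) (G : {set V}) (j t : nat) (st : @state _ T n).
Hypothesis I : state_invariant root par F lo hi q kk G j st.
Hypothesis size_opt : forall w, w != root -> size (opts st w) = t.
Variable z0 : V.
Hypothesis z0F : z0 \in F.
Hypothesis z0G : z0 \in G.
Hypothesis z0_good : z0 \notin bad st root.

Implicit Types c : {ffun T -> 'I_t}.

Fixpoint emb_fuel c (m : nat) u : V :=
  if m is m'.+1 then
    if u == root then z0 else opt st u (c u) (emb_fuel c m' (par u))
  else z0.

Definition emb c u := emb_fuel c (dist u).+1 u.
Arguments emb : simpl never.

Lemma emb_fuelE c m m' u : dist u < m -> dist u < m' -> emb_fuel c m u = emb_fuel c m' u.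
Proof.
elim: m m' u => // m IH [//|m'] u h h' /=.
case: eqP => // /eqP ur; congr (opt _ _ _ _).
have := dist_par tree ur => h''; apply: IH; lia.
Qed.

Lemma emb_root c : emb c root = z0.
Proof. by rewrite /emb /= eqxx. Qed.

Lemma embS c w : w != root -> emb c w = opt st w (c w) (emb c (par w)).
Proof.
move=> wr; rewrite {1}/emb /= (negbTE wr); congr (opt _ _ _ _).
by apply: emb_fuelE => //; exact: (dist_par tree).
Qed.

Lemma emb_eq c c' u : (forall y, anc par y u -> c y = c' y) -> emb c u = emb c' u.
Proof.
elim/tree_ind: u => [|w wr IH] h; first by rewrite !emb_root.
rewrite (embS c wr) (embS c' wr) h ?anc_refl // IH // => y yw; apply: h.
exact: anc_trans yw (anc_par _ _).
Qed.

Lemma emb_good c u : [/\ emb c u \in F, emb c u \notin bad st u & emb c u \in G].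
Proof.
elim/tree_ind: u => [|w wr [h1 h2 h3]]; first by rewrite emb_root.
have [|g1 /and5P[_ g2 _ g3 _] _ _] := inv_opt I wr h1 h2 (i := c w).
  by rewrite size_opt.
by rewrite (embS c wr).
Qed.

Lemma emb_step c w : w != root ->
  [/\ dsub (up par w) (emb c (par w)) (emb c w),
      generic par st w (emb c (par w)) (emb c w) &
      cands st w (emb c w) \subset cands st (par w) (emb c (par w))].
Proof.
move=> wr; have [h1 h2 h3] := emb_good c (par w).
have [|_ /and5P[_ _ _ _ /andP[g2 _]] g3 g4] := inv_opt I wr h1 h2 (i := c w).
  by rewrite size_opt.
by rewrite (embS c wr).
Qed.

Lemma emb_cands c w u : anc par w u -> cands st u (emb c u) \subset cands st w (emb c w).
Proof.
elim/tree_ind: u => [|u ur IH] wu; first by rewrite (anc_rootE wu).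
have [->//|neq] := eqVneq w u.
have [_ _ sub] := emb_step c ur; apply: subset_trans sub (IH _); exact: anc_neq.
Qed.

(** Induction climbs from [u] towards the root. Passing from [w] to [par w], the image of [u] is
    among the candidates of [w], so genericity decides its comparison with the image of [par w];
    [branch_lt] shows that the order of [T] obeys the same rule. *)
Lemma emb_anc c v u : anc par v u ->
  ((emb c v \subset emb c u) = (v <= u)%O) * ((emb c u \subset emb c v) = (u <= v)%O).
Proof.
case/anc_iter=> i ->; elim: i => [|i] /=; first by rewrite !subxx !lexx.
set w := iter i par u => IH.
have wu : anc par w u by apply/anc_iter; exists i.
have [e|wr] := eqVneq w root; first by rewrite e (par_root tree) -e.
have nwv : ~~ anc par w (par w) by apply: contra wr => /(anc_par_self tree) ->.
have [b1 b2] := branch_lt tree wu nwv.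
have neq : par w != u by apply: contraNneq nwv => ->.
have [zx /forall_inP gen _] := emb_step c wr.
have := gen (emb c u) (subsetP (emb_cands c wu) _ (inv_self I _ _)).
case: IH => IH1 IH2.
have [_ _ cov _] := tree.
move: zx; rewrite /up; case: (boolP (par w < w)%O) => [lt|nlt] /= zx /andP[ns /implyP imp].
- split.
  + apply/idP/idP => [/imp|]; first by rewrite IH1 => h; exact: le_trans (ltW lt) h.
    rewrite le_eqVlt (negbTE neq) /= => /b2[_ wleu _]; apply: subset_trans zx _.
    by rewrite IH1.
  + rewrite (negbTE ns) le_eqVlt eq_sym (negbTE neq) /=; apply/esym/negP => /b1[lt' _ _].
    by have := lt_trans lt lt'; rewrite ltxx.
- have lt : (w < par w)%O by case/orP: (cov w wr) => /covers_lt // h; rewrite h in nlt.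
  split.
  + rewrite (negbTE ns) le_eqVlt (negbTE neq) /=; apply/esym/negP => /b2[lt' _ _].
    by rewrite lt' in nlt.
  + apply/idP/idP => [/imp|]; first by rewrite IH2 => h; exact: le_trans h (ltW lt).
    rewrite le_eqVlt eq_sym (negbTE neq) /= => /b1[_ ulew _]; apply: subset_trans _ zx.
    by rewrite IH2.
Qed.

Lemma path_change c (a : 'I_n) v u : anc par v u -> (a \in emb c v) != (a \in emb c u) ->
  exists y : T, [/\ anc par y u, ~~ anc par y v, y != root & a \in symdiff (emb c (par y)) (emb c y)].
Proof.
elim/tree_ind: u => [|u ur IH] vu.
  by rewrite (anc_rootE vu) eqxx.
have [->|neq] := eqVneq v u; first by rewrite eqxx.
have vpu := anc_neq vu neq => avu.
have [au|au] := boolP (a \in symdiff (emb c (par u)) (emb c u)).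
  exists u; split => //; first exact: anc_refl.
  by apply: contra neq => uv; rewrite (anc_antisym tree vu uv).
have [|y [y1 y2 y3 y4]] := IH vpu.
  by move: au avu; rewrite inE negbK => /eqP ->.
by exists y; split=> //; apply: anc_trans y1 (anc_par _ _).
Qed.

(* [witness b u v] separates the images of [u] and [v]; the choice fails when some
   option off the path to [u] and to [v] moves it. *)
Definition witness c (b : bool) u v : option 'I_n :=
  [pick a in if b then emb c u :\: emb c v else emb c v :\: emb c u].

Definition clash (e : bool * T * T * T) c :=
  let: (b, u, v, y) := e in
  [&& y != root, ~~ anc par y u, ~~ anc par y v &
      if witness c b u v is Some a then a \in symdiff (emb c (par y)) (emb c y) else false].

Definition update c (y : T) (i : 'I_t) : {ffun T -> 'I_t} := [ffun u => if u == y then i else c u].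

(** Resample the option of [y] alone. As [y] is not an ancestor of [u], [v] or [par y], their images
    and hence the witness stay fixed, and at most two of the [t] options of [y] move the witness. *)
Lemma card_clash e : #|[set c | clash e c]| * t <= 2 * #|{ffun T -> 'I_t}|.
Proof.
case: e => [[[b u] v] y].
have [yr|] := boolP (y != root); last first.
  by move=> h; rewrite (_ : [set _ | _] = set0) ?cards0 //; apply/setP=> c; rewrite !inE /= (negbTE h).
have [yu|] := boolP (anc par y u).
  by rewrite (_ : [set _ | _] = set0) ?cards0 //; apply/setP=> c; rewrite !inE /= yu andbF.
have [yv|] := boolP (anc par y v).
  by rewrite (_ : [set _ | _] = set0) ?cards0 //; apply/setP=> c; rewrite !inE /= yv !andbF.
move=> yv yu; pose E := [set c | clash (b, u, v, y) c].
have fiber c : \sum_(i < t) (update c y i \in E) <= 2.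
  have upd u' i : ~~ anc par y u' -> emb (update c y i) u' = emb c u'.
    move=> yu'; apply: emb_eq => y' y'u'; rewrite ffunE; case: eqP => // e.
    by rewrite -e y'u' in yu'.
  have npy : ~~ anc par y (par y) by apply: contra yr => /(anc_par_self tree) ->.
  have wE i : witness (update c y i) b u v = witness c b u v.
    by rewrite /witness !upd.
  have [h1 h2 _] := emb_good c (par y).
  have [cnt2 _ _] := inv_cnt I yr h1 h2.
  case E': (witness c b u v) => [a|]; last first.
    by rewrite big1 // => i _; rewrite inE /= wE E' !andbF.
  apply: leq_trans (cnt2 a); rewrite /cnt.
  rewrite -sumn_count sumnE big_map (big_nth id) size_opt // big_mkord; apply: leq_sum => i _.
  rewrite inE /= wE E' yr yu yv /= (embS _ yr) !(upd (par y)) // ffunE eqxx.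
  exact: leqnn.
(* Swapping the old and the new option at [y] is an involution, so counting pairs before and after
   resampling gives the same number. *)
pose phi (p : {ffun T -> 'I_t} * 'I_t) := (update p.1 y p.2, p.1 y).
have phiK : involutive phi.
  case=> c i; rewrite /phi /=; congr (_, _); last by rewrite ffunE eqxx.
  by apply/ffunP=> u'; rewrite !ffunE; case: eqP => // ->.
have -> : #|E| * t = \sum_(p : {ffun T -> 'I_t} * 'I_t) (p.1 \in E).
  rewrite -(pair_bigA _ (fun c (i : 'I_t) => (c \in E) : nat)) /=.
  under eq_bigr => c _ do rewrite sum_nat_const card_ord mulnC.
  by rewrite -big_distrl -[in LHS]sum1_card big_mkcond; congr (_ * _); apply: eq_bigr => c _; case: (c \in E).
rewrite (reindex_inj (inv_inj phiK)) /= -(pair_bigA _ (fun c i => (update c y i \in E) : nat)) /=.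
apply: (@leq_trans (\sum_(c : {ffun T -> 'I_t}) 2)).
  by apply: leq_sum => c _; exact: fiber.
by rewrite sum_nat_const mulnC.
Qed.

Hypothesis t_big : 4 * #|T| ^ 3 < t.

(** There are [2 * #|T| ^ 3] possible clashes, each of probability at most 2/t, so [t_big] leaves a
    choice [c] without clashes. Vertices in one line of descent compare correctly by [emb_anc]; for
    the others the comparison is routed through the deepest common ancestor [v]. *)
Lemma embedding : exists f : {ffun T -> V}, induced_copy G f.
Proof.
have [c good] : exists c, forall e, ~~ clash e c.
  suff /existsP[c /forallP cP] : [exists c : {ffun T -> 'I_t}, [forall e, ~~ clash e c]] by exists c.
  apply: contraT; rewrite negb_exists => /forallP allbad.
  pose B := \bigcup_e [set c | clash e c].
  have BT : B = setT.
    apply/setP=> c; rewrite inE; apply/bigcupP.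
    have := allbad c; rewrite negb_forall => /existsP[e]; rewrite negbK => ce.
    by exists e; rewrite ?inE.
  have cB : #|B| * t <= 2 * #|{: bool * T * T * T}| * #|{ffun T -> 'I_t}|.
    apply: (@leq_trans ((\sum_e #|[set c | clash e c]|) * t)).
      rewrite leq_mul2r; apply/orP; right; rewrite /B.
      elim/big_rec2: _ => [|e a b _ IH]; first by rewrite cards0.
      by apply: leq_trans (leq_card_setU _ _) _; rewrite leq_add2l.
    rewrite big_distrl /=.
    apply: (@leq_trans (\sum_(e : bool * T * T * T) 2 * #|{ffun T -> 'I_t}|)).
      by apply: leq_sum => e _; exact: card_clash.
    by rewrite sum_nat_const mulnA (mulnC 2).
  have N0 : 0 < #|{ffun T -> 'I_t}|.
    by rewrite card_ffun card_ord expn_gt0; move: t_big; case: (t).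
  have lt : 2 * #|{: bool * T * T * T}| < t.
    by rewrite !card_prod card_bool; apply: leq_ltn_trans t_big; rewrite !expnS expn0 muln1 !mulnA leqnn.
  move: cB; rewrite BT cardsT; rewrite -(ltn_pmul2r N0) in lt.
  by move/(leq_ltn_trans)/(_ lt); rewrite mulnC ltnn.
have noclash b u v y : clash (b, u, v, y) c = false by apply/negbTE.
exists [ffun u => emb c u].
suff main u u' : (emb c u \subset emb c u') = (u <= u')%O.
  apply/and3P; split.
  - apply/injectiveP => u u'; rewrite !ffunE => e; apply/eqP.
    by rewrite eq_le -!main e subxx.
  - by apply/forallP => u; rewrite ffunE; case: (emb_good c u).
  - by apply/forallP => u; apply/forallP => u'; rewrite !ffunE properE !main lt_leAnge.
have [uu'|nuu'] := boolP (anc par u u'); first exact: (emb_anc c uu').1.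
have [u'u|nu'u] := boolP (anc par u' u); first exact: (emb_anc c u'u).2.
have exi : exists i, anc par (iter i par u) u'.
  by have /anc_iter[i e] := anc_root tree u; exists i; rewrite -e (anc_root tree).
case: (ex_minnP exi) => [[|i]]; first by rewrite (negbTE nuu').
rewrite /=; set w := iter i par u; set v := par w => vu' minv.
have wu : anc par w u by apply/anc_iter; exists i.
have vu : anc par v u by apply: anc_trans (anc_par _ _) wu.
have nwu' : ~~ anc par w u' by apply/negP => /minv; rewrite ltnn.
have key y : anc par y u -> anc par y u' -> anc par y v.
  case/anc_iter=> k -> /minv ik; apply/anc_iter; exists (k - i.+1).
  by rewrite /v -iterS -iterD subnK.
have [b1 b2] := branch_lt tree wu nwu'.
apply/idP/idP => [sub|]; last first.
  rewrite le_eqVlt => /orP[/eqP e|/b1[lt uw vu'le]]; first by rewrite e anc_refl in nuu'.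
  apply: (@subset_trans _ _ (emb c v)).
    by rewrite (emb_anc c vu).2; exact: le_trans uw (ltW lt).
  by rewrite (emb_anc c vu').1.
(* Otherwise the witness in the image of [u] but not of [v] lies in the image of [u'], so an edge
   between [v] and [u'] moves it: a clash. The symmetric argument puts the image of [v] inside that
   of [u']. *)
have [s1|s1] := boolP (emb c u \subset emb c v); last first.
  have := noclash true u v; rewrite /clash /witness; case: pickP => [a|none]; last first.
    by case/subsetPn: s1 => a a1 a2; have := none a; rewrite inE a1 a2.
  rewrite inE => /andP[av au] nc.
  have [|y [y1 y2 y3 y4]] := path_change (c := c) (a := a) vu'; first by rewrite (negbTE av) (subsetP sub).
  have := nc y; rewrite y3 y2 y4 /= andbT => /negbFE yu.
  by case/negP: y2; apply: key.
have [s2|s2] := boolP (emb c v \subset emb c u').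
  by move: s1 s2; rewrite (emb_anc c vu).2 (emb_anc c vu').1; exact: le_trans.
have := noclash false u' v; rewrite /clash /witness; case: pickP => [a|none]; last first.
  by case/subsetPn: s2 => a a1 a2; have := none a; rewrite inE a1 a2.
rewrite inE => /andP[au' av] nc.
have [|y [y1 y2 y3 y4]] := path_change (c := c) (a := a) vu.
  by rewrite av (negbTE (contra (subsetP sub a) au')).
have := nc y; rewrite y3 y2 y4 /= andbT => /negbFE yu.
by case/negP: y2; apply: key.
Qed.

End Embedding.

(** * An admissible order of the steps *)

Section StepOrder.
Context {d : Order.disp_t} {T : finPOrderType d}.
Variables (root : T) (par : T -> T) (dist : T -> nat).
Hypothesis tree : rooted_tree root par dist.

Lemma sorted_good_order done L : sorted (fun x y => dist y <= dist x) L ->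
  all (fun w => w != root) L ->
  (forall u w, u \in done -> w \in L -> dist w <= dist u) -> good_order root par done L.
Proof.
elim: L done => //= w L IH done srt /andP[wr Lr] le.
have tr : transitive (fun x y => dist y <= dist x) by move=> a b c /[swap]; apply: leq_trans.
rewrite wr /=; apply/andP; split.
  apply/negP => /le /(_ (mem_head _ _)); have := dist_par tree wr; lia.
apply: IH => //; first exact: path_sorted srt.
move=> u v; rewrite in_cons => /orP[/eqP->|ud] vL.
  by have /allP := order_path_min tr srt; apply.
by apply: le => //; rewrite in_cons vL orbT.
Qed.

(** List every vertex other than [root] [t] times and sort by decreasing distance from the root: a
    parent is strictly closer, so it comes after all its children. *)
Lemma step_order t : exists L, [/\ size L = t * #|T|.-1, good_order root par [::] L &
  forall w, w != root -> count_mem w L = t].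
Proof.
pose base := [seq w <- enum T | w != root].
pose L0 := flatten [seq nseq t w | w <- base].
pose L := sort (fun x y => dist y <= dist x) L0.
have cnt0 w (s : seq T) : count_mem w (flatten [seq nseq t x | x <- s]) = t * count_mem w s.
  elim: s => [|x s IH]; first by rewrite muln0.
  by rewrite /= count_cat count_nseq IH mulnDr mulnC /= (mulnC t).
exists L; split.
- have sz0 (s : seq T) : size (flatten [seq nseq t x | x <- s]) = t * size s.
    by elim: s => [|x s IH]; rewrite /= ?muln0 // size_cat size_nseq IH mulnS.
  rewrite size_sort sz0 size_filter -(cardC1 root) cardE.
  by rewrite {2}/enum_mem size_filter enumT; congr (_ * _); apply: eq_count.
- apply: sorted_good_order => //.
    by apply: sort_sorted => x y; exact: leq_total.
  apply/allP => w; rewrite mem_sort => /flattenP[s /mapP[x xb ->]].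
  by rewrite mem_nseq => /andP[_ /eqP->]; move: xb; rewrite mem_filter => /andP[].
- move=> w wr; have /seq.permP -> : perm_eq L L0 by rewrite perm_sort.
  rewrite cnt0 count_uniq_mem; last by apply: filter_uniq; exact: enum_uniq.
  by rewrite mem_filter wr mem_enum muln1.
Qed.

End StepOrder.

(** * Containers for families without an induced copy *)

Section Containers.
Context {d : Order.disp_t} {T : finPOrderType d}.
Hypothesis T_tree : tree_poset (T := T).

Definition steps := (4 * #|T| ^ 3).+1 * #|T|.-1.

Lemma containers_exist (R : realFieldType) n (F : {set {set 'I_n}}) lo hi q kk Dl m :
  (forall x, x \in F -> lo <= #|x| <= hi) -> 0 < q -> hi <= n -> m <= lo -> m <= n - hi ->
  0 < m -> 0 < kk -> 0 < Dl ->
  exists Cont : steps.-tuple {set {set 'I_n}} -> {set {set 'I_n}},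
    (forall SS, Cont SS \subset F /\
      ((#|Cont SS|)%:R * (1 - steps%:R * spoil lo hi q kk Dl m R steps)
         <= ('C(n, n./2) * (q * (height T).-1))%:R)%R) /\
    forall G : {set {set 'I_n}}, G \subset F -> Pfree (T := T) G ->
      exists SS : steps.-tuple {set {set 'I_n}},
        (forall S, S \in SS -> S \subset G /\ #|S| * Dl <= #|F|) /\ G \subset Cont SS.
Proof.
move=> band q0 hin mlo mhi m0 kk0 Dl0.
have [root [par [dist tree]]] := tree_poset_rooted T_tree.
have [L [szL goL cntL]] := step_order tree (4 * #|T| ^ 3).+1.
pose fin (SS : seq {set {set 'I_n}}) := run par F q kk Dl (@init_state _ T n F) L SS.
(* A member of [G] that is not bad for [root] would be the root of an induced copy by [embedding];
   so [G] also lies in the second set. *)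
exists (fun SS => cont (fin SS) :&: bad (fin SS) root); split.
  move=> SS; have sz : size SS = size L by rewrite size_tuple szL.
  split.
    by apply: subset_trans (subsetIl _ _) _; exact: (cont_run _ _ _ _ _ (@init_state _ T n F)).
  have := @card_container _ T root par dist tree n F lo hi q kk Dl m band q0 hin mlo mhi m0 kk0 R
    L SS (height T) _ level_height goL sz (subsetIl _ _) (subsetIr _ _).
  by rewrite szL.
move=> G GF Gfree.
have [SS [sz SSG GC]] := fingerprints par F q kk Dl0 (st := @init_state _ T n F) L GF.
have sz' : size SS == steps by rewrite sz szL.
exists (Tuple sz'); split => //=.
rewrite subsetI GC; apply/subsetP=> z zG; apply/negPn/negP => zb.
have I := invariant_run tree Dl band (invariant_init root par F lo hi q kk G) goL
  (fun u => ltac:(by [])) (fun S SS_S => proj1 (SSG S SS_S)) sz.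
have szo w : w != root -> size (opts (fin SS) w) = (4 * #|T| ^ 3).+1.
  by move=> wr; rewrite size_opts_run // cntL.
have [f fP] := embedding tree I szo (subsetP GF z zG) zG zb (ltnSn _).
by move: Gfree; rewrite /Pfree => /negP; apply; apply/existsP; exists f.
Qed.

End Containers.

(** * Asymptotics *)

(* The half-width [root7 n ^ 4] of the band lies between [n ^ (1/2)], which makes the outside
   negligible, and [n ^ (2/3)], which makes three random sets near [z] have no common
   element outside [z]. *)
Definition root7 n := \max_(s < n.+1 | s ^ 7 <= n) s.

Lemma root7_le n : root7 n ^ 7 <= n.
Proof.
rewrite /root7; elim/big_ind: _ => // x y hx hy.
by rewrite /maxn; case: ifP.
Qed.

Lemma root7_ge n s : s ^ 7 <= n -> s <= root7 n.
Proof.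
move=> h; have sn : s < n.+1.
  by rewrite ltnS; apply: leq_trans h; case: s => // s; rewrite expnS leq_pmulr // expn_gt0.
exact: (@leq_bigmax_cond _ (fun s : 'I_n.+1 => s ^ 7 <= n) (fun s => s : nat) (Ordinal sn)).
Qed.

Lemma root7_lt n : n < (root7 n).+1 ^ 7.
Proof. by rewrite ltnNge; apply/negP => /root7_ge; rewrite ltnn. Qed.

Definition width n := root7 n ^ 4.

Lemma width_le n : 2 <= root7 n -> 8 * width n <= n.
Proof.
move=> s2; apply: leq_trans (root7_le n); rewrite /width (expnD _ 3 4) leq_mul2r.
by apply/orP; right; rewrite -[8]/(2 ^ 3) leq_exp2r.
Qed.

Definition in_band n (x : {set 'I_n}) := n./2 - width n <= #|x| <= n./2 + width n.

Lemma archi_nat (R : archiRealFieldType) (x : R) : exists N : nat, (x <= N%:R)%R.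
Proof.
have [x0|x0] := lerP 0%R x; last by exists 0; apply: ltW.
by exists (Num.bound x); apply/ltW/archi_boundP.
Qed.

Lemma ler_frac (R : realFieldType) (a b c s : nat) : 0 < b -> 0 < s -> a * s <= c * b ->
  (a%:R / b%:R <= c%:R / s%:R :> R)%R.
Proof.
move=> b0 s0 h; rewrite ler_pdivrMr ?ltr0n // mulrAC ler_pdivlMr ?ltr0n //.
by rewrite -!natrM ler_nat.
Qed.

Section Asymptotic.
Context {d : Order.disp_t} {T : finPOrderType d}.
Hypothesis T_tree : tree_poset (T := T).
Variable R : realType.
Local Notation steps := (@steps d T).

(** With [hi - lo] equal to 2 s^4 and [n] at least s^7, the third term of [spoil] is of order kk s^4
    / n and the fourth of order s^8 / (n kk); [kk] equal to s^2 makes both O(1/s). The first term is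
    governed by [B] alone. *)
Lemma spoil_small (q B n : nat) (r := steps) (s := root7 n) :
  0 < q -> 0 < B -> B <= n -> 8 <= n -> 2 <= s ->
  (spoil (n./2 - width n) (n./2 + width n) q (s ^ 2) (n ^ q %/ B).+1 (n %/ 4) R r <=
   (2 * 8 ^ q * q`!)%:R / B%:R + (2 ^ (r + 5) + 48 * r)%:R / s%:R)%R.
Proof.
move=> q0 B0 Bn n8 s2; have wn := width_le s2; have s7 := root7_le n.
have g : n./2 + width n - (n./2 - width n) = 2 * s ^ 4.
  by rewrite -/(width n); lia.
rewrite -/s in s7; rewrite /spoil g.
set m := n %/ 4; have m8 : n <= 8 * m by rewrite /m; lia.
have m0 : 0 < m by rewrite /m; lia.
have s0 : 0 < s by lia.
have nq : B <= n ^ q by case: (q) q0 => // q' _; rewrite expnS; apply: leq_trans Bn _; rewrite leq_pmulr // expn_gt0; lia.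
have t1 : (((n ^ q %/ B).+1 * q`!)%:R / (m ^ q)%:R <= (2 * 8 ^ q * q`!)%:R / B%:R :> R)%R.
  apply: ler_frac => //; first by rewrite expn_gt0 m0.
  rewrite mulnAC [X in _ <= X]mulnAC leq_mul2r; apply/orP; right.
  apply: (@leq_trans (2 * n ^ q)).
    by rewrite mulSn; have := leq_trunc_div (n ^ q) B; lia.
  by rewrite -mulnA leq_mul2l -expnMn /=; apply: leq_expl.
have e7 : s ^ 7 = s * (s ^ 2 * s ^ 4) by rewrite -expnD -expnS.
have t2 : ((2 ^ r.+1 * (2 * s ^ 4))%:R / m%:R <= (2 ^ (r + 5))%:R / s%:R :> R)%R.
  apply: ler_frac => //.
  have -> : 2 ^ (r + 5) = 2 ^ r.+1 * 16 by rewrite expnD (expnS 2 r) (_ : 2 ^ 5 = 32) //; lia.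
  rewrite -!mulnA leq_mul2l; apply/orP; right.
  have : s * s ^ 4 <= s ^ 7 by rewrite e7 leq_mul2l leq_pmull ?orbT // expn_gt0 s0.
  lia.
have t3 : ((r * s ^ 2 * (2 * s ^ 4))%:R / m%:R <= (16 * r)%:R / s%:R :> R)%R.
  apply: ler_frac => //.
  rewrite (_ : _ * s = r * (2 * s ^ 7)); last by rewrite e7; ring.
  by rewrite (mulnC 16) -mulnA leq_mul2l; apply/orP; right; lia.
have t4 : ((r * (2 * s ^ 4) * (2 * s ^ 4))%:R / (m * s ^ 2)%:R <= (32 * r)%:R / s%:R :> R)%R.
  apply: ler_frac => //; first by rewrite muln_gt0 m0 expn_gt0 s0.
  have e4 : s ^ 4 = s ^ 2 * s ^ 2 by rewrite -expnD.
  rewrite (_ : _ * s = r * (4 * s ^ 7 * s ^ 2)); last by rewrite e7 e4; ring.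
  rewrite (_ : 32 * r * _ = r * (32 * m * s ^ 2)); last ring.
  rewrite leq_mul2l leq_mul2r; apply/orP; right; apply/orP; right; lia.
apply: le_trans (lerD (lerD (lerD t1 t2) t3) t4) _.
rewrite -!addrA lerD2l -!mulrDl -!natrD.
by rewrite (_ : 2 ^ (r + 5) + (16 * r + 32 * r) = 2 ^ (r + 5) + 48 * r) //; lia.
Qed.

Lemma containers_asymptotic (q : nat) (eps : R) : 0 < q -> (0 < eps)%R ->
  exists B N : nat, forall n, N <= n -> forall F : {set {set 'I_n}},
    (forall x, x \in F -> in_band x) ->
  exists Cont : steps.-tuple {set {set 'I_n}} -> {set {set 'I_n}},
    (forall SS, Cont SS \subset F /\
      ((#|Cont SS|)%:R <= ((q * (height T).-1)%:R + eps) * ('C(n, n./2))%:R)%R) /\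
    forall G : {set {set 'I_n}}, G \subset F -> Pfree (T := T) G ->
      exists SS : steps.-tuple {set {set 'I_n}},
        (forall S, S \in SS -> S \subset G /\ #|S| * n ^ q <= B * #|F|) /\ G \subset Cont SS.
Proof.
move=> q0 eps0; set K := (q * (height T).-1)%:R%R : R; set r := steps.
have K0 : (0 <= K)%R by rewrite ler0n.
(* Chosen so that (K + eps)(1 - dl) = K + eps/2 >= K: a spoiled fraction of at most [dl] raises the
   constant [K] to at most [K + eps]. *)
pose dl : R := (eps / (K + eps) / 2)%R.
have dl0 : (0 < dl)%R by rewrite !divr_gt0 // ltr_wpDl.
have [B BP] := archi_nat (2 * r%:R * (2 * 8 ^ q * q`!)%:R / dl)%R.
have [s0 sP] := archi_nat (2 * r%:R * (2 ^ (r + 5) + 48 * r)%:R / dl)%R.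
exists B.+1, (maxn (maxn 8 B.+1) ((maxn 2 s0.+1) ^ 7)) => n.
rewrite !geq_max => /andP[/andP[n8 nB] /root7_ge]; rewrite geq_max => /andP[s2 sn] F band.
have wn := width_le s2.
have s_gt0 : 0 < root7 n by lia.
have [||||||Cont [C1 C2]] := @containers_exist _ _ T_tree R n F (n./2 - width n) (n./2 + width n) q
  (root7 n ^ 2) (n ^ q %/ B.+1).+1 (n %/ 4) band q0.
- lia.
- lia.
- lia.
- lia.
- by rewrite expn_gt0 s_gt0.
- by [].
exists Cont; split; last first.
  move=> G GF Gfree; have [SS [SSP GC]] := C2 G GF Gfree; exists SS; split=> // S /SSP[SG Sc].
  split=> //; apply: leq_trans (leq_mul (leqnn B.+1) Sc).
  rewrite mulnCA leq_mul2l; apply/orP; right; rewrite mulnS mulnC addnC ltnW //.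
  by rewrite -ltn_subLR ?leq_trunc_div // {1}(divn_eq (n ^ q) B.+1) addKn ltn_mod.
move=> SS; have [CF cC] := C1 SS; split=> //.
set e := (_ * spoil _ _ _ _ _ _ _ _)%R in cC.
have e_le : (e <= dl)%R.
  have sp := spoil_small q0 (ltn0Sn B) nB n8 s2; rewrite -/r in sp.
  have r0 : (0 <= r%:R :> R)%R by rewrite ler0n.
  apply: le_trans (ler_wpM2l r0 sp) _.
  rewrite mulrDr; apply: (@le_trans _ _ (dl / 2 + dl / 2)%R); last by lra.
  apply: lerD.
    rewrite mulrA ler_pdivrMr ?ltr0n //.
    move: BP; rewrite ler_pdivrMr // => BP.
    have : (B%:R <= B.+1%:R :> R)%R by rewrite ler_nat.
    by move/(ler_wpM2r (ltW dl0)); nra.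
  rewrite mulrA ler_pdivrMr ?ltr0n //.
  move: sP; rewrite ler_pdivrMr // => sP.
  have : (s0%:R <= (root7 n)%:R :> R)%R by rewrite ler_nat ltnW.
  by move/(ler_wpM2r (ltW dl0)); nra.
have K_eps : (0 < K + eps)%R by rewrite ltr_wpDl.
have dlK : (dl * (K + eps) = eps / 2)%R.
  by rewrite /dl mulrAC divfK // gt_eqF.
have dl_lt1 : (dl <= 1 / 2)%R by rewrite /dl ler_pM2r ?invr_gt0 ?ltr0n // ler_pdivrMr // mul1r lerDr.
have key : (K <= (K + eps) * (1 - e))%R.
  have := ler_wpM2r (ltW K_eps) e_le; lra.
have e1 : (0 < 1 - e)%R by lra.
rewrite -(ler_pM2r e1); apply: le_trans cC _.
by rewrite natrM mulrAC [X in (X <= _)%R]mulrC; apply: ler_wpM2r key; rewrite ler0n.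
Qed.

End Asymptotic.

(** * Binomial coefficients in the middle and in the tails *)

Lemma expn2_le_bin n : 2 ^ n <= n.+1 * 'C(n, n./2).
Proof.
have -> : 2 ^ n = \sum_(i < n.+1) 'C(n, i).
  rewrite -[2]/(1 + 1) expnDn; apply: eq_bigr => i _.
  by rewrite !exp1n !muln1.
rewrite -[X in X * _]card_ord -sum_nat_const; apply: leq_sum => i _; exact: bin_half_max.
Qed.

Lemma leq_bin_half n : 2 <= n -> n <= 'C(n, n./2).
Proof. by move=> n2; have := bin_half_max n 1; rewrite bin1. Qed.

Lemma bin_antitone n i j : n./2 <= i -> i <= j -> 'C(n, j) <= 'C(n, i).
Proof.
move=> hi ij; rewrite -(subnKC ij); elim: (j - i) => [|a IH]; first by rewrite addn0.
apply: leq_trans IH; rewrite addnS -(leq_pmul2l (ltn0Sn (i + a))) mul_bin_left leq_mul2r.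
by apply/orP; right; lia.
Qed.

(** From level n/2 + 8e on, the ratio (n - j) / (j + 1) of consecutive coefficients is at most n /
    (n + 16e). *)
Lemma bin_decay n e i : 0 < n -> 'C(n, n./2 + 8 * e + i) * (n + 16 * e) ^ i <= 'C(n, n./2) * n ^ i.
Proof.
move=> n0; elim: i => [|i IH].
  by rewrite addn0 !expn0 !muln1 bin_half_max.
set j := n./2 + 8 * e + i in IH *.
rewrite addnS -/j -(leq_pmul2l (ltn0Sn j)) !mulnA mul_bin_left !expnS.
have ratio : (n - j) * (n + 16 * e) <= n * j.+1.
  have [nj|jn] := leqP n j; first by rewrite (eqP nj).
  have h1 : 2 * (n - j) + 16 * e <= n.+1 by rewrite /j; lia.
  have h2 : n + 16 * e <= (2 * j).+1 by rewrite /j; lia.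
  have : 2 * ((n - j) * (n + 16 * e)) <= (n.+1 - 16 * e) * (n + 16 * e).
    by rewrite mulnA leq_mul2r; apply/orP; right; lia.
  have : (n.+1 - 16 * e) * (n + 16 * e) <= n * (n.+1 + 16 * e).
    have e16 : 16 * e <= n.+1 by lia.
    rewrite mulnBl; move: (16 * e) e16 => f fn; nia.
  nia.
apply: (@leq_trans ('C(n, j) * (n + 16 * e) ^ i * (n * j.+1))).
  rewrite (_ : _ * _ * _ = 'C(n, j) * (n + 16 * e) ^ i * ((n - j) * (n + 16 * e))); last by ring.
  by rewrite leq_mul2l ratio orbT.
rewrite (_ : j.+1 * _ * _ = 'C(n, n./2) * n ^ i * (n * j.+1)); last by ring.
by rewrite leq_mul2r IH orbT.
Qed.

Lemma bernoulli n a e : n ^ e * (e * a) <= (n + a) ^ e * n.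
Proof.
suff : n ^ e * (n + e * a) <= (n + a) ^ e * n by apply: leq_trans; rewrite leq_mul2l leq_addl orbT.
elim: e => [|e IH]; first by rewrite mul0n addn0.
rewrite !expnS -!mulnA.
apply: (@leq_trans ((n + a) * (n ^ e * (n + e * a)))); last by rewrite leq_mul2l IH orbT.
by rewrite mulnCA [X in _ <= X]mulnCA leq_mul2l; apply/orP; right; nia.
Qed.

(** Over 8e levels the decay is the eighth power of (n / (n + 16e))^e, which Bernoulli bounds by n /
    (16 e^2). A fixed power replaces the exponential tail. *)
Lemma bin_tail n e : 0 < n -> 'C(n, n./2 + 16 * e) * (16 * e * e) ^ 8 <= 'C(n, n./2) * n ^ 8.
Proof.
move=> n0; have := bin_decay e (8 * e) n0.
rewrite -addnA -mulnDl -[8 + 8]/16 => dec.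
have := leq_expl 8 (bernoulli n (16 * e) e).
rewrite (expnMn (n ^ e)) (expnMn ((n + _) ^ e)) -!(expnM _ e) (mulnC e 8) (mulnCA e) mulnA => ber.
have ne0 : 0 < n ^ (8 * e) by rewrite expn_gt0 n0.
rewrite -(leq_pmul2l ne0).
set c := 'C(_, _) in dec *; set b := 'C(_, _) in dec *.
apply: (@leq_trans (c * ((n + 16 * e) ^ (8 * e) * n ^ 8))).
  by rewrite mulnCA leq_mul2l ber orbT.
move: (n ^ 8) => Y; rewrite !mulnA leq_mul2r; apply/orP; right.
by apply: leq_trans dec _; rewrite mulnC.
Qed.

(* With [s = root7 n] the width is [s ^ 4], so [bin_tail] gains a factor [s ^ 8] over the middle
   layer, while there are only [n + 1 <= (2 s) ^ 7 + 1] layers. *)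
Lemma card_outside_band : exists K : nat, forall n, 2 <= root7 n ->
  #|[set x : {set 'I_n} | ~~ in_band x]| * root7 n <= K * 'C(n, n./2).
Proof.
pose c1 := 64; pose c2 := 2 ^ 7.
suff [K KP] : exists K, forall n s e, 2 <= s -> s ^ 8 <= c1 * (16 * e * e) -> n <= c2 * s ^ 7 -> 0 < n ->
    forall X, X <= n.+1 * 'C(n, n./2 + 16 * e) -> X * s <= K * 'C(n, n./2).
  exists K => n s2; set s := root7 n in s2 *.
  have n0 : 0 < n by apply: leq_trans (root7_le n); rewrite expn_gt0; lia.
  have nlt : n <= c2 * s ^ 7.
    rewrite /c2 -expnMn; apply: leq_trans (ltnW (root7_lt n)) _; apply: leq_expl; rewrite -/s; lia.
  pose e := s ^ 4 %/ 16.
  have s16 : 16 <= s ^ 4 by rewrite -[16]/(2 ^ 4) leq_exp2r.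
  have e2 : s ^ 4 <= 32 * e by rewrite /e; lia.
  have e16 : 16 * e <= s ^ 4 by rewrite /e mulnC leq_trunc_div.
  apply: (KP n s e) => //.
    rewrite (_ : s ^ 8 = s ^ 4 * s ^ 4); last by rewrite -expnD.
    rewrite (_ : c1 * (16 * e * e) = (32 * e) * (32 * e)); last by rewrite /c1; ring.
    exact: leq_mul.
  apply: (@leq_trans (\sum_(i < n.+1) 'C(n, n./2 + 16 * e))); last by rewrite sum_nat_const card_ord.
  apply: (@leq_trans (\sum_(i < n.+1) #|[set x : {set 'I_n} | ~~ in_band x & #|x| == i]|)).
    have h := @card_le_sum _ _ (fun x : {set 'I_n} => ~~ in_band x) [set: 'I_n.+1]
      (fun i x => ~~ in_band x && (#|x| == i)).
    apply: leq_trans (h _) _; last first.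
      by rewrite big_mkcond; apply: leq_sum => i _; rewrite inE.
    move=> x xb; have xn : #|x| < n.+1 by rewrite ltnS card_set_ord.
    by exists (Ordinal xn); rewrite ?inE //= xb eqxx.
  apply: leq_sum => i _; have [iband|iband] := boolP (n./2 - width n <= i <= n./2 + width n).
    rewrite (_ : [set _ | _] = set0) ?cards0 //; apply/setP=> x; rewrite !inE.
    by apply/negP=> /andP[+ /eqP ci]; rewrite /in_band ci iband.
  have le : #|[set x : {set 'I_n} | ~~ in_band x & #|x| == i]| <= 'C(n, i).
    have := cards_draws [set: 'I_n] i; rewrite cardsT [X in 'C(X, _)]card_ord => <-.
    apply: subset_leq_card; apply/subsetP=> x.
    by rewrite !inE subsetT => /andP[_ ->].
  apply: leq_trans le _; move: iband; rewrite negb_and -!ltnNge /width -/s => /orP[lt|gt].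
    by rewrite -bin_sub; [apply: bin_antitone; lia | lia].
  by apply: bin_antitone; lia.
move: c1 c2 => c1 c2; exists (c1 ^ 8 * (2 * c2 ^ 9)) => n s e s2 h1 h2 n0 X XP.
have t := bin_tail e n0.
(* Multiplying by s^63 makes s^64 on the left, the eighth power of s^8, while n^9 on the right is
   O(s^63). *)
have s0 : 0 < s ^ 63 by rewrite expn_gt0; lia.
rewrite -(leq_pmul2l s0) mulnCA -expnSr.
apply: (@leq_trans (n.+1 * 'C(n, n./2 + 16 * e) * (c1 ^ 8 * (16 * e * e) ^ 8))).
  apply: leq_mul => //; rewrite -expnMn (expnM s 8 8); exact: leq_expl.
rewrite (_ : _ * _ * _ = n.+1 * c1 ^ 8 * ('C(n, n./2 + 16 * e) * (16 * e * e) ^ 8)); last by ring.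
apply: (@leq_trans (n.+1 * c1 ^ 8 * ('C(n, n./2) * n ^ 8))); first by rewrite leq_mul2l t orbT.
rewrite (_ : _ * _ * _ = c1 ^ 8 * 'C(n, n./2) * (n.+1 * n ^ 8)); last by ring.
rewrite (_ : s ^ 63 * _ = c1 ^ 8 * 'C(n, n./2) * (2 * (c2 ^ 9 * s ^ 63))); last by ring.
rewrite leq_mul2l; apply/orP; right.
apply: (@leq_trans (2 * n * n ^ 8)); first by rewrite leq_mul2r; apply/orP; right; lia.
rewrite -mulnA -expnS leq_mul2l (expnM s 7 9) -expnMn; apply/orP; right; exact: leq_expl.
Qed.

Lemma bin_near_half (R : realType) (i : nat) (eps : R) : (0 < eps)%R ->
  exists N, forall n, N <= n -> ((1 - eps) * ('C(n, n./2))%:R <= ('C(n, n./2 + i))%:R :> R)%R.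
Proof.
elim: i eps => [|i IH] eps eps0.
  by exists 0 => n _; rewrite addn0 ler_piMl ?ler0n //; lra.
have e2 : (0 < eps / 2)%R by lra.
have [N NP] := IH _ e2.
have [N1 N1P] := archi_nat ((2 * i + 2)%:R * 2 / eps * 2)%R.
exists (maxn N N1) => n; rewrite geq_max => /andP[/NP {}NP nN1].
have [e1|e1] := lerP 1%R eps.
  by apply: (@le_trans _ _ 0%R) => //; rewrite mulr_le0_ge0 //; lra.
set b := ('C(n, n./2))%:R%R in NP *; set j := n./2 + i in NP *.
have b0 : (0 <= b)%R by rewrite ler0n.
have rec : ((j.+1)%:R * ('C(n, j.+1))%:R = (n - j)%:R * ('C(n, j))%:R :> R)%R.
  by rewrite -!natrM mul_bin_left.
rewrite addnS -/j.
have nN : ((2 * i + 2)%:R * 2 * 2 <= eps * n%:R :> R)%R.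
  have : (N1%:R <= n%:R :> R)%R by rewrite ler_nat.
  move/(le_trans N1P); rewrite mulrAC ler_pdivrMr // => h; nra.
have h1 : ((j.+1)%:R <= (n - j)%:R + (2 * i + 2)%:R :> R)%R.
  by rewrite -natrD ler_nat /j; lia.
have h2 : (n%:R <= 2 * (j.+1)%:R :> R)%R by rewrite -natrM ler_nat /j; lia.
have h3 : ((1 - eps / 2) * (j.+1)%:R <= (n - j)%:R :> R)%R by nra.
have j0 : (0 < (j.+1)%:R :> R)%R by rewrite ltr0n.
rewrite -(ler_pM2l j0) rec.
apply: (@le_trans _ _ ((1 - eps / 2) * (j.+1)%:R * ((1 - eps / 2) * b))%R); last first.
  apply: ler_pM => //; first by rewrite mulr_ge0 ?ler0n //; lra.
  by rewrite mulr_ge0 //; lra.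
have : (0 <= j.+1%:R * b)%R by rewrite mulr_ge0 // ltW.
nra.
Qed.

Local Open Scope ring_scope.

(** * Random families *)

Section RandomSubset.
Variables (R : realType) (I : finType) (p : R).
Hypothesis p01 : 0 <= p <= 1.
Implicit Types (F S C : {set I}).

Definition weight F : R := p ^+ #|F| * (1 - p) ^+ (#|I| - #|F|)%N.
Definition pr (E : pred {set I}) : R := \sum_(F | E F) weight F.

Let p_ge0 : 0 <= p. Proof. by case/andP: p01. Qed.
Let q_ge0 : 0 <= 1 - p. Proof. by case/andP: p01; rewrite subr_ge0. Qed.

Lemma weight_ge0 F : 0 <= weight F.
Proof. by rewrite mulr_ge0 ?exprn_ge0. Qed.

Lemma prod_if_const F (a b : R) :
  \prod_i (if i \in F then a else b) = a ^+ #|F| * b ^+ (#|I| - #|F|)%N.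
Proof.
rewrite (bigID (mem F)) /= (eq_bigr (fun=> a)); last by move=> i ->.
rewrite [X in _ * X](eq_bigr (fun=> b)); last by move=> i /negbTE ->.
rewrite !prodr_const; congr (_ * _ ^+ _).
by have := cardC (mem F); rewrite -[X in _ = X](@eq_card I predT) // => <-; rewrite addKn; apply: eq_card.
Qed.

Lemma weight_prod (a b : I -> R) :
  \sum_F weight F * \prod_i (if i \in F then a i else b i) = \prod_i (p * a i + (1 - p) * b i).
Proof.
rewrite bigA_distr; apply: eq_bigr => F _; rewrite /weight -prod_if_const -big_split.
by apply: eq_bigr => i _; case: ifP.
Qed.

Lemma weight_sum : \sum_F weight F = 1.
Proof.
have := weight_prod (fun=> 1) (fun=> 1).
rewrite [X in _ = X]big1 => [<-|i _]; last by rewrite !mulr1 addrC subrK.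
by apply: eq_bigr => F _; rewrite big1 ?mulr1 // => i _; case: ifP.
Qed.

Lemma pr_le_expect (E : pred {set I}) (g : {set I} -> R) :
  (forall F, 0 <= g F) -> (forall F, E F -> 1 <= g F) -> pr E <= \sum_F weight F * g F.
Proof.
move=> g0 g1; rewrite [X in _ <= X](bigID E) /= -[X in X <= _]addr0; apply: lerD.
  by apply: ler_sum => F EF; rewrite ler_peMr ?weight_ge0 // g1.
by apply: sumr_ge0 => F _; rewrite mulr_ge0 ?weight_ge0.
Qed.

Lemma pr_sub (E E' : pred {set I}) : (forall F, E F -> E' F) -> pr E <= pr E'.
Proof.
move=> sub; rewrite /pr big_mkcond [X in _ <= X]big_mkcond; apply: ler_sum => F _.
by case EF: (E F); [rewrite (sub _ EF) | case: ifP => // _; exact: weight_ge0].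
Qed.

Lemma pr_union (J : finType) (A : pred J) (E : J -> pred {set I}) (E0 : pred {set I}) :
  (forall F, E0 F -> exists2 j, A j & E j F) -> pr E0 <= \sum_(j | A j) pr (E j).
Proof.
move=> cover.
under [X in _ <= X]eq_bigr => j _ do rewrite /pr big_mkcond.
rewrite exchange_big /= /pr big_mkcond; apply: ler_sum => F _.
have pos : 0 <= \sum_(j | A j) (if E j F then weight F else 0).
  by apply: sumr_ge0 => j _; case: ifP => // _; exact: weight_ge0.
case: ifP => // /cover[j Aj EjF]; rewrite (bigD1 j) //= EjF lerDl.
by apply: sumr_ge0 => j' _; case: ifP => // _; exact: weight_ge0.
Qed.

Lemma pr_compl (E : pred {set I}) : pr E = 1 - pr (predC E).
Proof. by rewrite -weight_sum (bigID E) /= addrK. Qed.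

Lemma pr_or (E E' : pred {set I}) : pr (fun F => E F || E' F) <= pr E + pr E'.
Proof.
have := @pr_union bool predT (fun b => if b then E else E') (fun F => E F || E' F).
rewrite big_bool /=; apply => F /orP[EF|EF]; by [exists true | exists false].
Qed.

Lemma prod_mem_const C (a : R) : \prod_i (if i \in C then a else 1) = a ^+ #|C|.
Proof. by rewrite prod_if_const expr1n mulr1. Qed.

(* Exponential tilting of [#|F :&: C|] on the event [S \subset F]. *)
Lemma upper_tail S C (theta tau : R) : 0 <= theta ->
  pr (fun F => (S \subset F) && (tau <= #|F :&: C|%:R)) <=
  (expR theta * p) ^+ #|S| * expR (p * (expR theta - 1) * #|C|%:R - theta * tau).
Proof.
move=> th0; set e := expR theta.
have e1 : 1 <= e by rewrite -expR0 ler_expR.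
pose a i : R := if i \in C then e else 1.
pose b i : R := if i \in S then 0 else 1.
have a1 i : 1 <= a i by rewrite /a; case: ifP.
pose g F := expR (- (theta * tau)) * \prod_i (if i \in F then a i else b i).
apply: (@le_trans _ _ (\sum_F weight F * g F)).
  apply: pr_le_expect => F.
    rewrite mulr_ge0 ?expR_ge0 // prodr_ge0 // => i _; case: ifP => _; first exact: le_trans (a1 i).
    by rewrite /b; case: ifP.
  case/andP=> /subsetP SF le; rewrite /g.
  have -> : \prod_i (if i \in F then a i else b i) = e ^+ #|F :&: C|.
    rewrite -prod_mem_const; apply: eq_bigr => i _; rewrite inE /a /b.
    by case iF: (i \in F) => //=; case: ifP => // /SF; rewrite iF.
  by rewrite /e -expRM_natl -expRD; apply: le_trans (expR_ge1Dx _); rewrite lerDl addrC subr_ge0 mulrC ler_wpM2r.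
have -> : \sum_F weight F * g F =
    expR (- (theta * tau)) * \sum_F weight F * \prod_i (if i \in F then a i else b i).
  by rewrite mulr_sumr; apply: eq_bigr => F _; rewrite /g mulrCA.
rewrite weight_prod expRD mulrA [X in _ <= X]mulrC ler_wpM2l ?expR_ge0 //.
(* The comparison is made factor by factor. The factor e p per element of [S], rather than p, covers
   the elements of [S] that also lie in [C]. *)
rewrite mulr_natr -mulr_natl expRM_natl -!prod_mem_const -big_split /=.
apply: ler_prod => i _; rewrite /a /b.
have h := expR_ge1Dx (p * (e - 1)).
have pe : 0 <= p * (e - 1) by rewrite mulr_ge0 // subr_ge0.
have p_le1 : p <= 1 by rewrite -subr_ge0.
set E := expR _ in h *.
have ep : 0 <= e * p * (E - 1) by rewrite !mulr_ge0 ?subr_ge0 ?expR_ge0 //; lra.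
have E1 : 1 <= E by lra.
have ep0 : p <= e * p by rewrite ler_peMl.
have p0 := p_ge0.
apply/andP; split; case: ifP => _; case: ifP => _; lra.
Qed.

Lemma lower_tail C (theta tau : R) : 0 <= theta ->
  pr (fun F => #|F :&: C|%:R <= tau) <=
  expR (theta * tau - p * (1 - expR (- theta)) * #|C|%:R).
Proof.
move=> th0; set e := expR (- theta).
have e1 : e <= 1 by rewrite expR_le1 oppr_le0.
have e0 : 0 < e := expR_gt0 _.
pose a i : R := if i \in C then e else 1.
pose g F := expR (theta * tau) * \prod_i (if i \in F then a i else 1).
apply: (@le_trans _ _ (\sum_F weight F * g F)).
  apply: pr_le_expect => F.
    by rewrite mulr_ge0 ?expR_ge0 // prodr_ge0 // => i _; rewrite /a; case: ifP => // _; case: ifP => // _; exact: ltW.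
  move=> le; rewrite /g.
  have -> : \prod_i (if i \in F then a i else 1) = e ^+ #|F :&: C|.
    by rewrite -prod_mem_const; apply: eq_bigr => i _; rewrite inE /a; case: (i \in F).
  by rewrite /e -expRM_natl -expRD; apply: le_trans (expR_ge1Dx _); rewrite lerDl mulrN subr_ge0 mulrC ler_wpM2l.
have -> : \sum_F weight F * g F =
    expR (theta * tau) * \sum_F weight F * \prod_i (if i \in F then a i else 1).
  by rewrite mulr_sumr; apply: eq_bigr => F _; rewrite /g mulrCA.
rewrite weight_prod expRD ler_wpM2l ?expR_ge0 //.
rewrite -mulNr mulr_natr -mulr_natl expRM_natl -!prod_mem_const.
apply: ler_prod => i _; rewrite /a.
have h := expR_ge1Dx (- (p * (1 - e))).
apply/andP; split; case: ifP => _; have := p_ge0; have := q_ge0; nra.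
Qed.

End RandomSubset.

(** * Counting tuples of fingerprints *)

Section CountingFamilies.
Variables (I : finType).

Lemma sum_subsets (R : comPzRingType) (C : {set I}) (x : R) :
  \sum_(U : {set I} | U \subset C) x ^+ #|U| = (1 + x) ^+ #|C|.
Proof.
have -> : (1 + x) ^+ #|C| = \prod_i ((if i \in C then x else 0) + 1).
  rewrite (bigID (mem C)) /= [X in _ * X]big1 => [|i /negbTE ->]; last by rewrite add0r.
  by rewrite mulr1 (eq_bigr (fun=> x + 1)) => [|i ->]; rewrite ?prodr_const // addrC.
rewrite bigA_distr big_mkcond; apply: eq_bigr => U _.
case: ifP => [/subsetP UC|/negbT/subsetPn[i iU iC]].
  rewrite (bigID (mem U)) /= [X in _ * X]big1 => [|i /negbTE -> //].
  by rewrite mulr1 (eq_bigr (fun=> x)) ?prodr_const // => i iU; rewrite iU UC.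
by rewrite (bigD1 i) //= iU (negbTE iC) mul0r.
Qed.

Lemma card_small_sets (s : nat) : (#|[set U : {set I} | #|U| <= s]| <= (#|I|.+1) ^ s)%N.
Proof.
pose im (f : {ffun 'I_s -> option I}) : {set I} := [set x | [exists i, f i == Some x]].
have sub : [set U : {set I} | #|U| <= s]%N \subset [set im f | f : {ffun 'I_s -> option I}].
  apply/subsetP=> U; rewrite inE => Us; apply/imsetP.
  exists [ffun i : 'I_s => onth (enum U) i] => //.
  apply/setP=> x; rewrite inE; apply/idP/existsP => [|[i]].
    rewrite -mem_enum => /onthP[j ej]; have js : (j < s)%N.
      by apply: leq_trans Us; rewrite cardE -onthTE ej.
    by exists (Ordinal js); rewrite ffunE /= ej.
  by rewrite ffunE -mem_enum => /eqP ei; apply/onthP; exists i.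
apply: leq_trans (subset_leq_card sub) _; apply: leq_trans (leq_imset_card _ _) _.
by rewrite card_ffun card_option card_ord.
Qed.

Lemma card_small_families (r s : nat) :
  (#|[set f : {ffun 'I_r -> {set I}} | [forall i, #|f i| <= s]]| <= (#|I|.+1) ^ (s * r))%N.
Proof.
have -> : [set f : {ffun 'I_r -> {set I}} | [forall i, #|f i| <= s]]%N =
    [set f in ffun_on [set U : {set I} | #|U| <= s]%N].
  apply/setP=> f; rewrite !inE; apply/forallP/ffun_onP => h i; have := h i; by rewrite inE.
by rewrite cardsE card_ffun_on card_ord expnM leq_expl // card_small_sets.
Qed.

(** A union has at most [r * s] elements, so each y may be replaced by y / exp l at the total price
    exp(l r s). Then at most 2^(r |U|) tuples have union U, and the sum over U is a binomial
    expansion. A large constant [l] makes the term with [#|C|] small, and its price is harmless when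
    [s] is small against p times [#|C|]. *)
Lemma sum_families (R : realType) (r s : nat) (C : {set I}) (y l : R) : 0 <= y -> 0 <= l ->
  \sum_(f : {ffun 'I_r -> {set I}} | [forall i, (f i \subset C) && (#|f i| <= s)%N])
     y ^+ #|\bigcup_i f i|
  <= expR (l * (r * s)%:R + 2 ^+ r * y * #|C|%:R / expR l).
Proof.
move=> y0 l0; set L := expR l; have L0 : 0 < L := expR_gt0 l.
have L1 : 1 <= L by rewrite -expR0 ler_expR.
have [x xE] : exists x, x = y / L by eexists.
have x0 : 0 <= x by rewrite xE divr_ge0 // ltW.
have card_le (f : {ffun 'I_r -> {set I}}) : [forall i, (f i \subset C) && (#|f i| <= s)%N] ->
    (#|\bigcup_i f i| <= r * s)%N.
  move/forallP => fP; apply: (@leq_trans (\sum_(i < r) s)); last by rewrite sum_nat_const card_ord.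
  apply: (@leq_trans (\sum_(i < r) #|f i|)).
    elim/big_rec2: _ => [|i a b _ IH]; first by rewrite cards0.
    by apply: leq_trans (leq_card_setU _ _) _; rewrite leq_add2l.
  by apply: leq_sum => i _; case/andP: (fP i).
apply: (@le_trans _ _ (L ^+ (r * s) * \sum_(f : {ffun 'I_r -> {set I}} | [forall i, f i \subset C])
     x ^+ #|\bigcup_i f i|)).
  rewrite mulr_sumr big_mkcond [X in _ <= X]big_mkcond; apply: ler_sum => f _.
  case: ifP => [fP|_]; last by case: ifP => // _; rewrite mulr_ge0 ?exprn_ge0 // ltW.
  have -> : [forall i, f i \subset C] by apply/forallP => i; case/andP: (forallP fP i).
  have -> : y = L * x by rewrite xE mulrCA divff ?mulr1 // gt_eqF.
  rewrite exprMn ler_wpM2r ?exprn_ge0 //; apply: ler_weXn2l => //; exact: card_le.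
rewrite expRD (mulrC l) expRM_natl; apply: ler_wpM2l; first by rewrite exprn_ge0 ?ltW.
rewrite (partition_big (fun f : {ffun 'I_r -> {set I}} => \bigcup_i f i) (fun U => U \subset C)) /=; last first.
  by move=> f /forallP fC; apply/bigcupsP => i _.
apply: (@le_trans _ _ (\sum_(U : {set I} | U \subset C) (2 ^+ r * x) ^+ #|U|)).
  apply: ler_sum => U UC.
  rewrite (eq_bigr (fun=> x ^+ #|U|)); last by move=> f /andP[_ /eqP ->].
  rewrite sumr_const [X in _ <= X]exprMn -[X in X <= _]mulr_natl; apply: ler_wpM2r; first exact: exprn_ge0.
  rewrite -exprM mulnC exprM -natrX -natrX ler_nat.
  have -> : ((2 ^ #|U|) ^ r)%N = #|ffun_on_mem 'I_r (mem (powerset U))|.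
    by rewrite card_ffun_on card_powerset card_ord.
  apply: subset_leq_card; apply/subsetP => f /andP[_ /eqP fU]; apply/ffun_onP => i.
  by rewrite powersetE -fU; exact: bigcup_sup.
rewrite sum_subsets.
have -> : 2 ^+ r * y * #|C|%:R / L = #|C|%:R * (2 ^+ r * x) by rewrite xE; ring.
rewrite expRM_natl; apply: lerXn2r; rewrite ?nnegrE ?expR_ge0 ?expR_ge1Dx //.
by rewrite addr_ge0 // mulr_ge0 // exprn_ge0.
Qed.

End CountingFamilies.

Section RealBounds.
Variable R : realType.
Implicit Types (x : R).

Lemma expR_le_quad x : 0 <= x <= 1 / 2 -> expR x <= 1 + x + 2 * x ^+ 2.
Proof.
move=> /andP[x0 x1]; have h := expR_ge1Dx (- x); rewrite expRN in h.
have e0 : 0 < expR x := expR_gt0 x.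
have : (1 - x) * expR x <= 1.
  by have := ler_wpM2r (ltW e0) h; rewrite mulVf ?gt_eqF.
rewrite expr2 => h1; nra.
Qed.

Lemma expRN_le_quad x : 0 <= x -> expR (- x) <= 1 - x + x ^+ 2.
Proof.
move=> x0; have h := expR_ge1Dx x.
have e0 : 0 < expR (- x) := expR_gt0 _.
have : (1 + x) * expR (- x) <= 1.
  by have := ler_wpM2r (ltW e0) h; rewrite -expRD subrr expR0.
rewrite expr2 => h1; nra.
Qed.

Lemma expR1_ge2 : 2 <= expR 1 :> R.
Proof. by have := expR_ge1Dx (1 : R); lra. Qed.

Lemma expRN_le_inv x : 0 < x -> expR (- x) <= x^-1.
Proof.
move=> x0; rewrite expRN lef_pV2 ?posrE ?expR_gt0 //.
by have := expR_ge1Dx x; lra.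
Qed.

End RealBounds.

Lemma card_sets n : #|{set 'I_n}| = (2 ^ n)%N.
Proof. by rewrite -cardsT -powersetT card_powerset cardsT card_ord. Qed.

(** A free [G] inside the random family forces, for one tuple, both that its fingerprints are
    present and that its container is overfull. [upper_tail] bounds the joint event, keeping the
    factor for presence that [sum_families] sums. *)
Lemma container_union (R : realType) (I : finType) (p : R) (r s : nat) (C : {set I})
  (free : pred {set I}) (Cont : r.-tuple {set I} -> {set I}) (a theta tau l : R) :
  0 <= p <= 1 -> 0 <= theta -> 0 <= l ->
  (forall SS, (#|Cont SS|)%:R <= a) ->
  (forall G : {set I}, G \subset C -> free G -> exists SS : r.-tuple {set I},
     (forall S, S \in SS -> S \subset G /\ (#|S| <= s)%N) /\ G \subset Cont SS) ->
  pr p (fun F => [exists G : {set I}, [&& G \subset F :&: C, free G & tau <= #|G|%:R]]) <=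
  expR (l * (r * s)%:R + 2 ^+ r * (expR theta * p) * #|C|%:R / expR l
        + (p * (expR theta - 1) * a - theta * tau)).
Proof.
move=> p01 th0 l0 Ca cover; have /andP[p0 _] := p01.
pose A (f : {ffun 'I_r -> {set I}}) := [forall i, (f i \subset C) && (#|f i| <= s)%N].
pose E (f : {ffun 'I_r -> {set I}}) (F : {set I}) :=
  (\bigcup_i f i \subset F) && (tau <= #|F :&: Cont [tuple f i | i < r]|%:R).
apply: le_trans (pr_union p01 (A := A) (E := E) _) _.
  move=> F /existsP[G /and3P[GFC Gfree tauG]].
  move: (GFC); rewrite subsetI => /andP[GF GC].
  have [SS [SSG GCont]] := cover G GC Gfree.
  exists [ffun i => tnth SS i].
    apply/forallP => i; rewrite ffunE; have [SG Ss] := SSG _ (mem_tnth i SS).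
    by rewrite Ss (subset_trans SG).
  rewrite /E; apply/andP; split.
    apply/bigcupsP => i _; rewrite ffunE; have [SG _] := SSG _ (mem_tnth i SS).
    exact: subset_trans SG GF.
  have -> : [tuple [ffun i => tnth SS i] i | i < r] = SS.
    by apply: eq_from_tnth => i; rewrite tnth_mktuple ffunE.
  apply: le_trans tauG _; rewrite ler_nat; apply: subset_leq_card.
  by rewrite subsetI GF GCont.
pose e := expR (p * (expR theta - 1) * a - theta * tau).
have th1 : 0 <= expR theta - 1.
  by rewrite subr_ge0; apply: le_trans (expR_ge1Dx _); rewrite lerDl.
apply: (@le_trans _ _ (\sum_(f | A f) (expR theta * p) ^+ #|\bigcup_i f i| * e)).
  apply: ler_sum => f _; apply: le_trans (upper_tail p01 _ _ _ th0) _.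
  apply: ler_wpM2l; first by rewrite exprn_ge0 // mulr_ge0 ?expR_ge0.
  rewrite ler_expR lerD2r ler_wpM2l ?Ca //; exact: mulr_ge0.
rewrite -mulr_suml expRD; apply: ler_wpM2r; first exact: expR_ge0.
by apply: sum_families => //; rewrite mulr_ge0 ?expR_ge0.
Qed.

(** * Middle layers and the two rounds of containers *)

Section Poset.
Context {d : Order.disp_t} {T : finPOrderType d}.

Lemma Pfree_sub n (G H : {set {set 'I_n}}) : G \subset H -> Pfree (T := T) H -> Pfree (T := T) G.
Proof.
move/subsetP=> GH; apply: contra => /existsP[f /and3P[f1 /forallP f2 f3]].
by apply/existsP; exists f; rewrite /induced_copy f1 f3 andbT /=; apply/forallP => x; exact: GH.
Qed.

Definition layers n : {set {set 'I_n}} :=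
  [set x : {set 'I_n} | n./2 <= #|x| < n./2 + (height T).-1]%N.

Lemma in_layers n (x : {set 'I_n}) :
  (x \in layers n) = (n./2 <= #|x| < n./2 + (height T).-1)%N.
Proof. by rewrite inE. Qed.

Lemma layers_free n : (0 < #|T|)%N -> Pfree (T := T) (layers n).
Proof.
case/card_gt0P => x0 _; have h0 := leq_ltn_trans (leq0n _) (level_height x0).
apply/negP=> /existsP[f /and3P[_ /forallP fL /forallP fP]].
have P0 : is_chain (set0 : {set T}) by apply/forall_inP=> ?; rewrite inE.
have [C chC cC] : exists2 C : {set T}, is_chain C & #|C| = height T.
  rewrite /height (@bigop.bigmax_eq_arg _ set0 (fun C => is_chain C) _ P0).
  by case: arg_maxnP => // C chC _; exists C.
have fL' x := etrans (esym (in_layers (f x))) (fL x).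
pose g x := inord (#|f x| - n./2) : 'I_(height T).-1.+1.
have gE x : g x = (#|f x| - n./2)%N :> nat.
  by rewrite inordK //; have := fL' x; lia.
have : (#|g @: C| <= #|[set i : 'I_(height T).-1.+1 | i < (height T).-1]%N|)%N.
  apply: subset_leq_card; apply/subsetP => i /imsetP[x _ ->]; rewrite inE gE.
  by have := fL' x; lia.
have lt_card x y : (x < y)%O -> (#|f x| < #|f y|)%N.
  by have /forallP/(_ y)/eqP := fP x => <-; exact: proper_card.
have injg : {in C &, injective g}.
  move=> x y xC yC e; have /forall_inP/(_ x xC)/forall_inP/(_ y yC) := chC.
  have ef : #|f x| = #|f y|.
    have e' : (#|f x| - n./2 = #|f y| - n./2)%N by rewrite -!gE e.
    have /andP[h1 _] := fL' x; have /andP[h2 _] := fL' y.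
    by rewrite -(subnK h1) e' subnK.
  by rewrite !le_eqVlt => /orP[] /orP[/eqP-> //|/lt_card]; rewrite ef ltnn.
rewrite card_in_imset // cC leqNgt => /negP; apply.
rewrite (_ : [set _ | _] = [set~ ord_max]); last first.
  by apply/setP=> i; rewrite !inE -val_eqE /=; have := ltn_ord i; lia.
by rewrite cardsC1 card_ord; move: h0; lia.
Qed.

Lemma card_layers (R : realType) (eps : R) : 0 < eps -> exists N : nat, forall n, (N <= n)%N ->
  ((height T).-1%:R - eps) * ('C(n, n./2))%:R <= #|layers n|%:R :> R.
Proof.
move=> eps0; set k1 := (height T).-1.
pose e1 := eps / (k1%:R + 1); have k10 : 0 < k1%:R + 1 :> R by rewrite ltr_wpDl ?ler0n.
have e10 : 0 < e1 by rewrite divr_gt0.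
have [N NP] : exists N : nat, forall n i, (N <= n)%N -> (i < k1)%N ->
    (1 - e1) * ('C(n, n./2))%:R <= ('C(n, n./2 + i))%:R :> R.
  elim: k1 {e1 k10 eps0} (e1) e10 => [|k IH] e e0; first by exists 0%N.
  have [N1 h1] := IH e e0; have [N2 h2] := bin_near_half k e0.
  exists (maxn N1 N2) => n i; rewrite geq_max => /andP[n1 n2].
  by rewrite ltnS leq_eqVlt => /orP[/eqP->|]; [exact: h2 | exact: h1].
exists N => n nN; apply: (@le_trans _ _ (\sum_(i < k1) ('C(n, n./2 + i))%:R)).
  apply: (@le_trans _ _ (\sum_(i < k1) ((1 - e1) * ('C(n, n./2))%:R))); last first.
    by apply: ler_sum => i _; exact: NP.
  rewrite sumr_const card_ord -[X in _ <= X]mulr_natl mulrA; apply: ler_wpM2r => //.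
  have : e1 * (k1%:R + 1) = eps by rewrite /e1 divfK // gt_eqF.
  nra.
rewrite -natr_sum ler_nat.
have -> : (\sum_(i < k1) 'C(n, n./2 + i) = \sum_(i < k1) #|[set x : {set 'I_n} | #|x| == n./2 + i]|)%N.
  apply: eq_bigr => i _.
  have := cards_draws [set: 'I_n] (n./2 + i); rewrite cardsT [X in 'C(X, _)]card_ord => <-.
  by apply: eq_card => x; rewrite !inE subsetT.
under eq_bigr => i _ do rewrite -sum1dep_card big_mkcond.
rewrite exchange_big -sum1dep_card [X in (_ <= X)%N]big_mkcond; apply: leq_sum => x _ /=.
rewrite -big_mkcond /= sum1_card; case: ifP => [_|xL].
  apply/card_le1_eqP => i j; rewrite !unfold_in => /eqP e1' /eqP e2'; apply/val_inj/eqP => /=.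
  by rewrite -(eqn_add2l n./2) -e1' e2'.
rewrite leqn0; apply/eqP; apply: eq_card0 => i; rewrite unfold_in; apply/negP => /eqP cx.
move: xL; rewrite cx leq_addr ltn_add2l; have := ltn_ord i; rewrite {2}/k1 => ->.
by [].
Qed.

Section Upper.
Hypothesis T_tree : tree_poset (T := T).
Variables (R : realType) (eps : R).
Hypothesis eps_gt0 : 0 < eps.

Let k1 : R := (height T).-1%:R.
(** The tilting parameter: it makes the quadratic error 2 theta^2 (k1 + eps/4) at most half of the
    linear gain theta eps/2. *)
Let theta : R := eps / (8 * (k1 + eps)).

Lemma k1_ge0 : 0 <= k1. Proof. by rewrite ler0n. Qed.

Lemma theta_eq : theta * (k1 + eps) = eps / 8.
Proof.
have := k1_ge0; have := eps_gt0 => h1 h2.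
by rewrite /theta; field; rewrite gt_eqF //; lra.
Qed.

Lemma theta_bounds : 0 < theta <= 1 / 8.
Proof.
have := k1_ge0; have := eps_gt0 => h1 h2; have te := theta_eq.
have t0 : 0 < theta by rewrite divr_gt0 // mulr_gt0 //; lra.
rewrite t0 /=; nra.
Qed.

Lemma expR_theta : expR theta - 1 <= theta + 2 * theta ^+ 2 /\ 1 <= expR theta <= 2.
Proof.
have /andP[t0 t8] := theta_bounds.
have h : expR theta <= 1 + theta + 2 * theta ^+ 2 by apply: expR_le_quad; apply/andP; split; lra.
have h' := expR_ge1Dx theta; rewrite expr2 in h *.
split; first by lra.
apply/andP; split; first by lra.
nra.
Qed.

(** The excess 3/4 [eps] lies above the container size, which has excess [eps / 4], and leaves
    [eps / 4] for the sets outside the band. *)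
Definition has_large (n : nat) (p : R) (F : {set {set 'I_n}}) : bool :=
  [exists G : {set {set 'I_n}}, [&& G \subset F, Pfree (T := T) G &
     (k1 + 3 / 4 * eps) * p * ('C(n, n./2))%:R <= #|G|%:R]].

(** All counting costs are multiples of [mu], that is M / n, while the gain is a multiple of p M; so
    a large constant lower bound on p n absorbs them. *)
Lemma large_rare : exists (c : R) (N : nat), forall n (p : R), (N <= n)%N -> 0 <= p <= 1 ->
  c <= p * n%:R ->
  pr p (fun F : {set {set 'I_n}} => has_large p (F :&: [set x | in_band x])) <=
  expR (- (theta * eps / 8 * (p * ('C(n, n./2))%:R))).
Proof.
have /andP[t0 t8] := theta_bounds; have k10 := k1_ge0; have e0 := eps_gt0.
have [et1 /andP[et2 et3]] := expR_theta.
have [BA [NA HA]] := containers_asymptotic T_tree (q := 3) isT (ltr01 : 0 < 1 :> R).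
have e4 : 0 < eps / 4 by lra.
have [BB [NB HB]] := containers_asymptotic T_tree (q := 1) isT e4.
set r := steps in HA HB.
pose K : R := (3 * (height T).-1)%:R + 1.
have K0 : 0 <= K by rewrite addr_ge0.
(* As exp l >= l, this brings the term of [sum_families] below theta eps/16 times p M. *)
pose l : R := 2 ^+ r.+1 * K * 16 / (theta * eps).
have te0 : 0 < theta * eps by rewrite mulr_gt0.
have l0 : 0 <= l by rewrite divr_ge0 ?(ltW te0) // !mulr_ge0 ?exprn_ge0.
pose c1 : R := 4 * r%:R * BA%:R + l * r%:R * BB%:R * K.
exists (16 * c1 / (theta * eps)), (maxn 2 (maxn NA NB)) => n p.
rewrite !geq_max => /and3P[n2 nA nB] p01 cn; have /andP[p0 p1] := p01.
set M : R := ('C(n, n./2))%:R.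
have M0 : 0 <= M by rewrite ler0n.
have n_gt0 : (0 < n)%N := ltnW n2.
have n0 : 0 < n%:R :> R by rewrite ltr0n.
pose mu := M / n%:R; have mu0 : 0 <= mu by rewrite divr_ge0 // ltW.
have muM : mu * n%:R = M by rewrite /mu divfK // gt_eqF.
pose y := p * M; have y0 : 0 <= y by rewrite mulr_ge0.
have c1mu : c1 * mu <= theta * eps / 16 * y.
  move: cn; rewrite ler_pdivrMr // => cn.
  have -> : y = p * n%:R * mu by rewrite /y -muM; ring.
  by have := ler_wpM2r mu0 cn; clear; lra.
have band_in x : x \in [set x : {set 'I_n} | in_band x] -> in_band x by rewrite inE.
have [Cont [CA1 CA2]] := HA n nA [set x | in_band x] band_in.
pose sA := (BA * 2 ^ n %/ n ^ 3)%N.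
pose sB (C : {set {set 'I_n}}) := (BB * #|C| %/ n)%N.
have n3 : (0 < n ^ 3)%N by rewrite expn_gt0 n_gt0.
have CA_card SS : #|Cont SS|%:R <= K * M by case: (CA1 SS).
pose A (f : {ffun 'I_r -> {set {set 'I_n}}}) := [forall i, (#|f i| <= sA)%N].
pose E (f : {ffun 'I_r -> {set {set 'I_n}}}) (F : {set {set 'I_n}}) :=
  has_large p (F :&: Cont [tuple f i | i < r]).
have step1 : pr p (fun F : {set {set 'I_n}} => has_large p (F :&: [set x | in_band x])) <=
    \sum_(f | A f) pr p (E f).
  apply: (pr_union p01) => F /existsP[G /and3P[GFC Gfree Glarge]].
  move: (GFC); rewrite subsetI => /andP[GF GC].
  have [SS [SSG GCont]] := CA2 G GC Gfree.
  exists [ffun i => tnth SS i].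
    apply/forallP => i; rewrite ffunE; have [_ Ss] := SSG _ (mem_tnth i SS).
    rewrite /sA leq_divRL //; apply: leq_trans Ss _; rewrite leq_mul2l; apply/orP; right.
    by rewrite -(card_sets n) max_card.
  apply/existsP; exists G; rewrite Gfree Glarge subsetI GF andbT /=.
  have -> : [tuple [ffun i => tnth SS i] i | i < r] = SS.
    by apply: eq_from_tnth => i; rewrite tnth_mktuple ffunE.
  by rewrite GCont.
pose a : R := (k1 + eps / 4) * M.
pose tau : R := (k1 + 3 / 4 * eps) * p * M.
(* Second round, inside the fixed first-round container. The tilting gains theta eps/4 and the
   presence sum returns theta eps/16, which leaves 3/16. *)
have step2 f : pr p (E f) <= expR (l * r%:R * BB%:R * K * mu - 3 / 16 * (theta * eps) * y).
  pose C := Cont [tuple f i | i < r]; have CC : C \subset [set x | in_band x] by case: (CA1 [tuple f i | i < r]).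
  have C_band x : x \in C -> in_band x by move/(subsetP CC)/band_in.
  have [D [D1 D2]] := HB n nB C C_band.
  have D_card SS : #|D SS|%:R <= a by case: (D1 SS) => _; rewrite mul1n.
  have cover (G : {set {set 'I_n}}) : G \subset C -> Pfree (T := T) G ->
      exists SS : r.-tuple {set {set 'I_n}},
     (forall S, S \in SS -> S \subset G /\ (#|S| <= sB C)%N) /\ G \subset D SS.
    move=> GC Gf; have [SS [SSP GD]] := D2 G GC Gf; exists SS; split=> // S /SSP[SG Sc].
    by split=> //; rewrite /sB leq_divRL // -[n in (_ * n)%N]expn1.
  have cu := container_union tau p01 (ltW t0) l0 D_card cover.
  apply: (@le_trans _ _ (pr p (fun F => [exists G : {set {set 'I_n}},
      [&& G \subset F :&: C, Pfree (T := T) G & tau <= #|G|%:R]]))); first by [].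
  apply: le_trans cu _; rewrite ler_expR.
  have Cc : #|C|%:R <= K * M := CA_card _.
  have b1 : l * (r * sB C)%:R <= l * r%:R * BB%:R * K * mu.
    have : (sB C)%:R * n%:R <= BB%:R * (#|C|%:R : R) by rewrite -!natrM ler_nat leq_trunc_div.
    have bb0 : 0 <= BB%:R :> R by rewrite ler0n.
    move/le_trans/(_ (ler_wpM2l bb0 Cc)); rewrite -muM => h.
    have h' : (sB C)%:R <= BB%:R * K * mu.
      by rewrite -(ler_pM2r n0); apply: le_trans h _; rewrite !mulrA.
    have -> : l * r%:R * BB%:R * K * mu = l * r%:R * (BB%:R * K * mu) by ring.
    by rewrite natrM mulrA ler_wpM2l // mulr_ge0.
  have b2 : 2 ^+ r * (expR theta * p) * #|C|%:R / expR l <= theta * eps / 16 * y.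
    have el : l <= expR l by have := expR_ge1Dx l; clear; lra.
    have el0 : 0 < expR l := expR_gt0 l.
    rewrite ler_pdivrMr //.
    have r0 : 0 <= 2 ^+ r :> R by rewrite exprn_ge0.
    apply: (@le_trans _ _ (2 ^+ r.+1 * K * y)).
      have -> : 2 ^+ r.+1 * K * y = 2 ^+ r * (2 * p) * (K * M) by rewrite /y exprS; ring.
      apply: ler_pM => //; first by rewrite !mulr_ge0 ?expR_ge0.
      by rewrite ler_wpM2l // ler_wpM2r.
    have -> : 2 ^+ r.+1 * K = theta * eps / 16 * l by rewrite /l; field; rewrite !gt_eqF.
    by rewrite mulrAC; apply: ler_wpM2l => //; rewrite mulr_ge0 //; clear -te0; lra.
  have b3 : p * (expR theta - 1) * a - theta * tau <= - (theta * eps / 4 * y).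
    have a0 : 0 <= (k1 + eps / 4) * y by rewrite mulr_ge0 //; clear -k10 e0; lra.
    have -> : p * (expR theta - 1) * a = (expR theta - 1) * ((k1 + eps / 4) * y) by rewrite /a /y; ring.
    have b30 := ler_wpM2r a0 et1.
    have -> : theta * tau = theta * (k1 + 3 / 4 * eps) * y by rewrite /tau /y; ring.
    have te := theta_eq.
    have b31 : theta * (2 * (theta * (k1 + eps / 4))) * y <= theta * (eps / 4) * y.
      rewrite ler_wpM2r // ler_wpM2l ?ltW //; clear -te t0 e0; nra.
    rewrite expr2 in b30; clear -b30 b31; lra.
  have b4 := lerD (lerD b1 b2) b3; clear -b4; lra.
(* The presence of the first-round fingerprints is not exploited: a fingerprint has O(mu / n)
   members, each chosen among 2^n sets, so the crude count is already exp(O(mu)). *)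
have countA : #|[set f | A f]|%:R <= expR (4 * r%:R * BA%:R * mu) :> R.
  have h := card_small_families {set 'I_n} r sA.
  apply: (@le_trans _ _ (((2 ^ n.+1) ^ (sA * r))%N%:R)).
    rewrite ler_nat; apply: leq_trans h _; rewrite card_sets; apply: leq_expl.
    by rewrite expnS; have := expn_gt0 2 n; clear; lia.
  rewrite -expnM natrX; apply: (@le_trans _ _ (expR 1 ^+ (n.+1 * (sA * r)))).
    by apply: lerXn2r; rewrite ?nnegrE ?expR_ge0 //; exact: expR1_ge2.
  rewrite -expRM_natl ler_expR mulr1 natrM (natrM _ sA).
  have : sA%:R * (n%:R * (n%:R * n%:R)) <= BA%:R * (2 * n%:R * M) :> R.
    rewrite -!natrM ler_nat (_ : n * (n * n) = n ^ 3)%N; last by rewrite !expnS expn0 muln1.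
    apply: leq_trans (leq_trunc_div _ _) _; rewrite leq_mul2l; apply/orP; right.
    by apply: leq_trans (expn2_le_bin n) _; rewrite leq_mul2r; apply/orP; right; move: n2; clear; lia.
  have -> : BA%:R * (2 * n%:R * M) = BA%:R * 2 * mu * (n%:R * n%:R) by rewrite -muM; ring.
  rewrite mulrA ler_pM2r ?mulr_gt0 // => h1.
  have n1 : n.+1%:R <= 2 * n%:R :> R by rewrite -natrM ler_nat; move: n2; clear; lia.
  have r0 : 0 <= r%:R :> R by rewrite ler0n.
  have s0 : 0 <= sA%:R :> R by rewrite ler0n.
  have h2 : n.+1%:R * sA%:R <= 4 * BA%:R * mu :> R.
    by apply: (@le_trans _ _ (2 * n%:R * sA%:R)); [exact: ler_wpM2r | clear -h1 te0; lra].
  have -> : 4 * r%:R * BA%:R * mu = 4 * BA%:R * mu * r%:R by ring.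
  by rewrite mulrA; exact: ler_wpM2r.
apply: le_trans step1 _.
apply: (@le_trans _ _ (\sum_(f | A f) expR (l * r%:R * BB%:R * K * mu - 3 / 16 * (theta * eps) * y))).
  by apply: ler_sum => f _; exact: step2.
rewrite sumr_const -[X in X <= _]mulr_natl -cardsE.
apply: le_trans (ler_wpM2r (expR_ge0 _) countA) _.
rewrite -expRD ler_expR -/M -/y.
rewrite /c1 in c1mu; clear -c1mu; lra.
Qed.

End Upper.
End Poset.

(** * The three exceptional events and the conclusion *)

Section Final.
Context {d : Order.disp_t} {T : finPOrderType d}.
Hypothesis T_tree : tree_poset (T := T).
Variables (R : realType) (eps : R).
Hypothesis eps_gt0 : 0 < eps.

Let k1 : R := (height T).-1%:R.
Let theta : R := eps / (8 * (k1 + eps)).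
Let k10 : 0 <= k1. Proof. exact: k1_ge0. Qed.
Let teq : theta * (k1 + eps) = eps / 8. Proof. exact: theta_eq. Qed.
Let tb : 0 < theta <= 1 / 8. Proof. exact: theta_bounds. Qed.

Lemma outside_rare : exists N : nat, forall n (p : R), (N <= n)%N -> 0 <= p <= 1 ->
  pr p (fun F : {set {set 'I_n}} => eps / 4 * (p * ('C(n, n./2))%:R) <=
     #|F :&: [set x | ~~ in_band x]|%:R) <=
  expR (- (theta * eps / 8 * (p * ('C(n, n./2))%:R))).
Proof.
have /andP[t0 t8] := tb; have [et1 /andP[et2 et3]] := @expR_theta _ T _ _ eps_gt0.
have [K KP] := card_outside_band; have [s sP] := archi_nat (K%:R * 16 / eps).
exists (maxn 2 s ^ 7)%N => n p /root7_ge; rewrite geq_max => /andP[s2 sr] p01.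
have /andP[p0 _] := p01; set M : R := ('C(n, n./2))%:R; have M0 : 0 <= M by rewrite ler0n.
set out := [set x | _].
have c_out : #|out|%:R <= eps / 16 * M.
  have s0 : 0 < (root7 n)%:R :> R by rewrite ltr0n (leq_trans _ s2).
  rewrite -(ler_pM2r s0); apply: (@le_trans _ _ (K%:R * M)).
    by rewrite /M -!natrM ler_nat KP.
  have : (s%:R <= (root7 n)%:R :> R) by rewrite ler_nat.
  move/(le_trans sP); rewrite ler_pdivrMr // => h.
  by have := ler_wpM2r M0 h; lra.
have := upper_tail p01 set0 out (eps / 4 * (p * M)) (ltW t0).
rewrite cards0 expr0 mul1r => h; apply: le_trans (le_trans _ h) _.
  by apply: (pr_sub p01) => F hF; rewrite sub0set.
rewrite ler_expR.
have b : p * (expR theta - 1) * #|out|%:R <= p * (2 * theta) * (eps / 16 * M).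
  apply: ler_pM => //; first by rewrite mulr_ge0 // subr_ge0.
  apply: ler_wpM2l => //; move: et1; rewrite -/theta expr2; nra.
by apply: (@le_trans _ _ (p * (2 * theta) * (eps / 16 * M) - theta * (eps / 4 * (p * M)))); [rewrite lerD2r | lra].
Qed.

Lemma few_layers_rare : exists N : nat, forall n (p : R), (N <= n)%N -> 0 <= p <= 1 ->
  pr p (fun F : {set {set 'I_n}} => #|F :&: layers (T := T) n|%:R <= (k1 - eps) * (p * ('C(n, n./2))%:R)) <=
  expR (- (theta * eps / 8 * (p * ('C(n, n./2))%:R))).
Proof.
have /andP[t0 t8] := tb; have e2 : 0 < eps / 2 by rewrite divr_gt0.
have [N NP] := card_layers (T := T) e2; exists N => n p nN p01; have /andP[p0 _] := p01.
have := NP n nN; rewrite -/k1; set M : R := ('C(n, n./2))%:R => cL.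
have M0 : 0 <= M by rewrite ler0n.
apply: le_trans (lower_tail p01 _ _ (ltW t0)) _; rewrite ler_expR.
set L := #|_|%:R in cL *.
have h := expRN_le_quad (ltW t0).
have L0 : 0 <= L by rewrite ler0n.
have tt : 0 <= theta - theta ^+ 2 by rewrite expr2; nra.
have b1 : p * (theta - theta ^+ 2) * ((k1 - eps / 2) * M) <= p * (1 - expR (- theta)) * L.
  apply: (@le_trans _ _ (p * (theta - theta ^+ 2) * L)).
    by apply: ler_wpM2l => //; rewrite mulr_ge0.
  by apply: ler_wpM2r => //; apply: ler_wpM2l => //; lra.
have y0 : 0 <= p * M by rewrite mulr_ge0.
have b2 : theta ^+ 2 * (k1 - eps / 2) * (p * M) <= theta * (eps / 8) * (p * M).
  apply: ler_wpM2r => //; rewrite expr2 -mulrA ler_wpM2l ?(ltW t0) //.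
  have te0 : 0 <= theta * eps := mulr_ge0 (ltW t0) (ltW eps_gt0).
  by move: teq te0; rewrite mulrDr mulrBr; lra.
have tey : 0 <= theta * eps * (p * M) by rewrite mulr_ge0 // mulr_ge0 ?(ltW t0) ?(ltW eps_gt0).
lra.
Qed.

(** The layers inside [F] form a free family, which gives the lower bound. For the upper bound a
    free family is split at the band, and 3/4 [eps] inside and 1/4 [eps] outside add up. *)
Lemma max_free_bounds n (p : R) (F : {set {set 'I_n}}) : 0 <= p ->
  #|F :&: [set x | ~~ in_band x]|%:R < eps / 4 * (p * ('C(n, n./2))%:R) ->
  ~~ has_large (T := T) eps p (F :&: [set x | in_band x]) ->
  (k1 - eps) * (p * ('C(n, n./2))%:R) < #|F :&: layers (T := T) n|%:R ->
  `| (max_free T F)%:R - k1 * p * ('C(n, n./2))%:R | <= eps * p * ('C(n, n./2))%:R.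
Proof.
move=> p0; set M : R := ('C(n, n./2))%:R => out small low.
have M0 : 0 <= M by rewrite ler0n.
have y0 : 0 <= p * M by rewrite mulr_ge0.
have e0 := eps_gt0.
rewrite ler_distl; apply/andP; split.
  apply: (@le_trans _ _ (#|F :&: layers (T := T) n|%:R)); first by move: low; lra.
  rewrite ler_nat /max_free.
  apply: (@leq_bigmax_cond _ _ (fun G : {set {set 'I_n}} => #|G|)).
  rewrite subsetIl /=; apply: Pfree_sub (subsetIr _ _) _; apply: layers_free.
  by case: T_tree.
rewrite /max_free; elim/big_ind: _ => [|a b ha hb|G /andP[GF Gf]].
- by rewrite -!mulrA -mulrDl mulr_ge0 // addr_ge0 // ltW.
- by rewrite /maxn; case: ifP.
have GE : (#|G| <= #|G :&: [set x | in_band x]| + #|F :&: [set x | ~~ in_band x]|)%N.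
  apply: leq_trans (leq_card_setU _ _); apply: subset_leq_card; apply/subsetP=> x xG.
  by rewrite !inE xG (subsetP GF) //=; case: (in_band x).
have : #|G :&: [set x | in_band x]|%:R < (k1 + 3 / 4 * eps) * p * M.
  rewrite ltNge; apply: contra small => big; apply/existsP; exists (G :&: [set x | in_band x]).
  by rewrite setSI //= big andbT; apply: Pfree_sub Gf; exact: subsetIl.
move: GE; rewrite -(ler_nat R) natrD; move: out; lra.
Qed.

End Final.

Theorem theorem1p6 (d : Order.disp_t) (T : finPOrderType d) (k : nat)
  (R : realType) (p : nat -> R) :
  tree_poset (T := T) -> height T = k ->
  (forall n, 0 <= p n <= 1) ->
  (forall M : R, exists N : nat, forall n : nat, (N <= n)%N -> M <= p n * n%:R) ->
  forall eps : R, 0 < eps -> forall delta : R, 0 < delta ->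
  exists N : nat, forall n : nat, (N <= n)%N ->
    1 - delta <= prob_Pnq n (p n)
      [pred F | `| (max_free T F)%:R - (k - 1)%N%:R * p n * 'C(n, n./2)%:R |
                  <= eps * p n * 'C(n, n./2)%:R].
Proof.
move=> T_tree <- p01 pn eps eps0 delta delta0; rewrite subn1.
set k1 : R := (height T).-1%:R; pose theta : R := eps / (8 * (k1 + eps)).
have /andP[t0 t8] : 0 < theta <= 1 / 8 := @theta_bounds _ T _ _ eps0.
have [N1 h1] := @outside_rare _ T _ _ eps0; have [N2 h2] := @few_layers_rare _ T _ _ eps0.
have [c [N3 h3]] := large_rare T_tree eps0.
have te0 : 0 < theta * eps by rewrite mulr_gt0.
(* By exp(-x) <= 1/x with x = theta eps y / 8, each exceptional event has probability at most
   delta/3 as soon as y >= 24 / (delta theta eps); and y >= p n because the middle layer has at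
   least n sets. *)
have [N4 h4] := pn c; have [N5 h5] := pn (24 / (delta * (theta * eps))).
exists (maxn 2 (maxn (maxn N1 N2) (maxn N3 (maxn N4 N5)))) => n.
rewrite !geq_max => /and3P[n2 /andP[n1 n2'] /and3P[n3 n4 n5]].
have pn01 := p01 n; have /andP[p0 _] := pn01.
set M : R := 'C(n, n./2)%:R.
set Ev := [pred F | _]; rewrite -[prob_Pnq _ _ _]/(pr (p n) Ev) pr_compl lerD2l lerN2.
set y := p n * M.
have small : expR (- (theta * eps / 8 * y)) <= delta / 3.
  have ny : p n * n%:R <= y by rewrite /y ler_wpM2l // ler_nat leq_bin_half.
  have dte : 0 < delta * (theta * eps) by rewrite mulr_gt0.
  have : 24 <= y * (delta * (theta * eps)).
    by rewrite -ler_pdivrMr //; exact: le_trans (h5 n n5) ny.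
  move=> h24; have y0 : 0 < y.
    by rewrite -(pmulr_lgt0 _ dte); lra.
  have q0 : 0 < theta * eps / 8 * y by rewrite mulr_gt0 // divr_gt0.
  apply: le_trans (expRN_le_inv q0) _.
  by rewrite -(ler_pM2r q0) mulVf ?gt_eqF //; lra.
pose E1 (F : {set {set 'I_n}}) := eps / 4 * (p n * M) <= #|F :&: [set x | ~~ in_band x]|%:R.
pose E2 (F : {set {set 'I_n}}) := #|F :&: layers (T := T) n|%:R <= (k1 - eps) * (p n * M).
pose E3 (F : {set {set 'I_n}}) := has_large (T := T) eps (p n) (F :&: [set x | in_band x]).
apply: (@le_trans _ _ (pr (p n) E1 + (pr (p n) E2 + pr (p n) E3))).
  apply: le_trans (lerD (lexx _) (pr_or pn01 E2 E3)).
  apply: le_trans (pr_or pn01 E1 (fun F => E2 F || E3 F)).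
  apply: (pr_sub pn01) => F; apply: contraNT; rewrite !negb_or -!ltNge.
  case/and3P=> e1 e2 e3; exact: max_free_bounds.
have b1 : pr (p n) E1 <= delta / 3 := le_trans (h1 n _ n1 pn01) small.
have b2 : pr (p n) E2 <= delta / 3 := le_trans (h2 n _ n2' pn01) small.
have b3 : pr (p n) E3 <= delta / 3 := le_trans (h3 n _ n3 pn01 (h4 n n4)) small.
lra.
Qed.
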